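(* Let $(\Theta,d)$ be a connected metric space indexing the family $\{p_\theta\}_{\theta\in\Theta}$, and let $x_1,x_2,\dots$ be i.i.d. samples from $w$. Suppose $(\theta,x,y)\mapsto V_\theta(x,y)$ is jointly continuous on $\Theta\times G\times G$ and $\sup_{\theta\in K}V_\theta(x,x)$ is $w$-integrable for every compact $K\subset\Theta$. Suppose further that $\Theta=\Theta_1\times\Theta_2$, where $\Theta_1$ is compact and $\Theta_2$ is a convex subset of a Euclidean space, and that for each fixed $\theta_1\in\Theta_1$, $\mathrm{wKSD}_n(\theta_1,\cdot)$ is convex on $\Theta_2$ and $\mathrm{KSD}(\theta_1,\cdot)$ attains its minimum value on a non-empty compact set $\tilde\Theta_0(\theta_1)\subset\mathrm{int}(\Theta_2)$. Let $\Theta_0\subset\Theta$ be the set of global minimizers of $\mathrm{KSD}(\theta)$ over $\Theta$, and let $\widehat\Theta_n\subset\Theta$ be the (random) set of global minimizers of $\mathrm{wKSD}_n(\theta)$ over $\Theta$. Then, almost surely, $\Theta_0$ and $\widehat\Theta_n$ are non-empty for large $n$, and $$\sup_{\theta\in\widehat\Theta_n}d(\theta,\Theta_0)\to0\quad\text{as }n\to\infty.$$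
   Context: $G$ is a connected Lie group with left-invariant Haar measure $\mu$, of dimension $m$; all densities are with respect to $\mu$. The modular function $\Delta:G\to(0,\infty)$ is defined by $\mu(Sg)=\Delta(g)\mu(S)$ for Borel sets $S$. $D^1,\dots,D^m$ is a left-invariant basis (left-invariant vector fields forming a basis of the tangent space at every point). $k:G\times G\to\mathbb{R}$ is a positive definite kernel with reproducing kernel Hilbert space $\mathcal{H}_k$; $k$ is $C_0$-universal if $\mathcal{H}_k$ is contained in, and dense in sup norm in, the space $C_0(G)$ of continuous functions vanishing at infinity. $\mathcal{H}_k^m$ is the $m$-fold product with $\langle f,g\rangle_{\mathcal{H}_k^m}=\sum_l\langle f_l,g_l\rangle_{\mathcal{H}_k}$. For a locally Lipschitz probability density $p$ and $h\in\mathcal{H}_k$ put $\mathcal{A}^l_ph:=D^lh+h\,D^l\log p+h\,D^l\log\Delta$ ($D^l\log p:=0$ where $p=0$); for $f\in\mathcal{H}_k^m$ put $\mathcal{A}_pf:=\sum_l\mathcal{A}^l_pf_l$. Put $\mathrm{KSD}(p,q):=\sup\{\mathbb{E}_q[\mathcal{A}_pf]:f\in\mathcal{H}_k^m,\|f\|_{\mathcal{H}_k^m}\le1\}$. Let $\mathcal{A}^l_pk_x\in\mathcal{H}_k$ be obtained by letting $\mathcal{A}^l_p$ act on the first argument of $k$ and fixing that argument at $x$, and put $k_p(x,y):=\sum_l\langle\mathcal{A}^l_pk_x,\mathcal{A}^l_pk_y\rangle_{\mathcal{H}_k}$. $\{p_\theta\}$ is a family of locally Lipschitz probability densities on $G$,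 $q$ a locally Lipschitz probability density, and $w$ a strictly positive probability density (the sampling density). Write $\mathrm{KSD}(\theta):=\mathrm{KSD}(p_\theta,q)$, $$V_\theta(x,y):=k_{p_\theta}(x,y)\,q(x)q(y)w(x)^{-1}w(y)^{-1},\qquad \mathrm{wKSD}_n^2(\theta):=\frac1{n^2}\sum_{i,j=1}^nV_\theta(x_i,x_j),$$ and $\mathrm{wKSD}_n(\theta)\ge0$ is the square root of the latter. Standing assumptions: $k\in C^2(G\times G)$ is $C_0$-universal, and for every $\theta$ the functions $\sqrt{k_{p_\theta}(x,x)}$ and $D^l\log(p_\theta/q)$ (all $l$) are integrable with respect to both $p_\theta$ and $q$. *)

(* Defs.v *)
From HB Require Import structures.
From mathcomp Require Import all_boot all_order all_algebra.
From mathcomp Require Import all_classical all_reals all_analysis.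

Set Implicit Arguments.
Unset Strict Implicit.
Unset Printing Implicit Defensive.

Import Order.TTheory GRing.Theory Num.Theory.
Import numFieldNormedType.Exports.

Local Open Scope classical_set_scope.
Local Open Scope ring_scope.

(* Class C^n on the open set [U].  The order goes up by one when f is
   differentiable and all its directional derivatives are of the previous
   order; this is the usual class C^n when [E] is finite-dimensional. *)
Fixpoint Cn (R : realType) (E F : normedModType R) (n : nat) (U : set E)
    (f : E -> F) {struct n} : Prop :=
  match n with
  | 0 => forall x, U x -> {for x, continuous f}
  | n'.+1 => (forall x, U x -> differentiable f x) /\
             (forall v, Cn n' U (fun x => 'D_v f x))
  end.

Definition smooth (R : realType) (E F : normedModType R) (U : set E)
  (f : E -> F) : Prop := forall n, Cn n U f.

(* The smooth structure is given by an atlas indexed by the points of the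
   group: [chart x] maps the open neighbourhood [chart_dom x] of [x]
   homeomorphically onto an open set of R^m, with inverse [param x].  Outside
   their domains [chart x] and [param x] are arbitrary. *)
HB.mixin Record isLieGroup (R : realType) (m : nat) G
    of Group G & PointedTopological G := {
  chart_dom : G -> set G;
  chart : G -> G -> 'rV[R]_m;
  param : G -> 'rV[R]_m -> G;
  lie_hausdorff : hausdorff_space G;
  lie_second_countable : @second_countable G;
  chart_dom_open : forall x, open (chart_dom x);
  chart_dom_self : forall x, chart_dom x x;
  chart_img_open : forall x, open (chart x @` chart_dom x);
  chartK : forall x y, chart_dom x y -> param x (chart x y) = y;
  chart_continuous : forall x, {within chart_dom x, continuous (chart x)};
  param_continuous : forall x,
    {within chart x @` chart_dom x, continuous (param x)};
  chart_smooth : forall x y,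
    smooth [set u | (chart x @` chart_dom x) u /\ chart_dom y (param x u)]
           (fun u => chart y (param x u));
  lie_mul_continuous : continuous (fun z : G * G => (z.1 * z.2)%g);
  lie_inv_continuous : continuous (fun z : G => (z^-1)%g);
  lie_mul_smooth : forall x y z,
    smooth [set u : 'rV[R]_m * 'rV[R]_m |
              [/\ (chart x @` chart_dom x) u.1, (chart y @` chart_dom y) u.2
                & chart_dom z (param x u.1 * param y u.2)%g]]
           (fun u => chart z (param x u.1 * param y u.2)%g);
  lie_inv_smooth : forall x y,
    smooth [set u | (chart x @` chart_dom x) u /\
                    chart_dom y ((param x u)^-1)%g]
           (fun u => chart y ((param x u)^-1)%g)
}.

#[short(type="lieGroupType")]
HB.structure Definition LieGroup (R : realType) (m : nat) :=
  {G of isLieGroup R m G & Group G & PointedTopological G}.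

Notation borel G := (g_sigma_algebraType (@open G)).

Section LieGroupCalculus.
Context (R : realType) (m : nat) (G : lieGroupType R m).

(* Tangent vectors are identified with coordinate vectors through the chart
   based at their own base point: [X x] lists the components of the
   vector at [x] in [chart x]. *)
Definition vector_field : Type := G -> 'rV[R]_m.

(* Where the directional derivative does not exist, the value is 0. *)
Definition vf_apply (X : vector_field) (h : G -> R) (x : G) : R :=
  'D_(X x) (fun u : 'rV[R]_m => h (param x u) : R^o) (chart x x).

(* The differential of the translation by g, read in the charts based at x and
   g x, sends [X x] to [X (g x)]. *)
Definition left_invariant (X : vector_field) : Prop :=
  forall g x, X (g * x)%g =
    'D_(X x) (fun u : 'rV[R]_m => chart (g * x)%g (g * param x u)%g)
             (chart x x).

Definition left_invariant_basis (D : 'I_m -> vector_field) : Prop :=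
  (forall l, left_invariant (D l)) /\
  (forall x, basis_of fullv [seq D l x | l : 'I_m]).

(* All Riemannian distances, and the distances in charts, are locally
   equivalent, so they define the same locally Lipschitz functions. *)
Definition locally_lipschitz (p : G -> R) : Prop :=
  forall x, exists2 U, nbhs (chart x x) U &
    [lipschitz (p (param x u) : R^o) | u in U].

Definition C2_kernel (k : G -> G -> R) : Prop :=
  forall x y, Cn 2 ((chart x @` chart_dom x) `*` (chart y @` chart_dom y))
    (fun z : 'rV[R]_m * 'rV[R]_m => k (param x z.1) (param y z.2) : R^o).

Definition left_haar (mu : {measure set (borel G) -> \bar R}) : Prop :=
  [/\ forall (g : G) (S : set (borel G)), measurable S ->
        mu [set (g * s)%g | s in (S : set G)] = mu S,
      forall K : set G, compact K -> (mu K < +oo)%E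
    & mu [set: borel G] <> 0%E].

Definition modular_function (mu : {measure set (borel G) -> \bar R})
    (Delta : G -> R) : Prop :=
  (forall g, 0 < Delta g) /\
  (forall (g : G) (S : set (borel G)), measurable S ->
     mu [set (s * g)%g | s in (S : set G)] = ((Delta g)%:E * mu S)%E).

Definition probability_density (mu : {measure set (borel G) -> \bar R})
    (p : G -> R) : Prop :=
  [/\ measurable_fun [set: borel G] (p : borel G -> R),
      forall x, 0 <= p x
    & (\int[mu]_x (p x)%:E)%E = 1%E].

End LieGroupCalculus.

Definition positive_definite (R : realType) (G : Type) (k : G -> G -> R) :
    Prop :=
  (forall x y, k x y = k y x) /\
  (forall (n : nat) (c : 'I_n -> R) (x : 'I_n -> G),
     0 <= \sum_(i < n) \sum_(j < n) c i * c j * k (x i) (x j)).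

(* The reproducing kernel Hilbert space of [k], as a space of functions; by
   Moore-Aronszajn it exists and is unique when [k] is positive definite.
   [rkhs_ip] is meaningful only on the carrier. *)
Record rkhs (R : realType) (G : Type) (k : G -> G -> R) := Rkhs {
  rkhs_carrier : set (G -> R);
  rkhs_ip : (G -> R) -> (G -> R) -> R;
  rkhs_zero : rkhs_carrier (fun=> 0);
  rkhs_linear : forall (a : R) f g, rkhs_carrier f -> rkhs_carrier g ->
    rkhs_carrier (fun x => a * f x + g x);
  rkhs_ip_linear : forall (a : R) f g h,
    rkhs_carrier f -> rkhs_carrier g -> rkhs_carrier h ->
    rkhs_ip (fun x => a * f x + g x) h = a * rkhs_ip f h + rkhs_ip g h;
  rkhs_ip_sym : forall f g, rkhs_carrier f -> rkhs_carrier g ->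
    rkhs_ip f g = rkhs_ip g f;
  rkhs_ip_ge0 : forall f, rkhs_carrier f -> 0 <= rkhs_ip f f;
  rkhs_ip_eq0 : forall f, rkhs_carrier f -> rkhs_ip f f = 0 -> f = fun=> 0;
  rkhs_complete : forall f : nat -> G -> R, (forall n, rkhs_carrier (f n)) ->
    (forall e : R, 0 < e -> exists N, forall i j, (N <= i)%N -> (N <= j)%N ->
       rkhs_ip (fun x => f i x - f j x) (fun x => f i x - f j x) < e) ->
    exists2 g, rkhs_carrier g &
      (fun n => rkhs_ip (fun x => f n x - g x) (fun x => f n x - g x))
        @ \oo --> (0 : R);
  rkhs_kernel : forall x, rkhs_carrier (k x);
  rkhs_reproducing : forall f x, rkhs_carrier f -> f x = rkhs_ip f (k x)
}.

Definition C0 (R : realType) (G : topologicalType) (f : G -> R) : Prop :=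
  continuous f /\
  (forall e : R, 0 < e ->
     exists2 K : set G, compact K & forall x, ~ K x -> `|f x| < e).

Definition C0_universal (R : realType) (G : topologicalType)
    (k : G -> G -> R) (H : rkhs k) : Prop :=
  (forall h, rkhs_carrier H h -> C0 h) /\
  (forall f : G -> R, C0 f -> forall e : R, 0 < e ->
     exists2 h, rkhs_carrier H h & forall x, `|h x - f x| <= e).

Section Stein.
Context (R : realType) (m : nat) (G : lieGroupType R m).
Context (mu : {measure set (borel G) -> \bar R}).
Context (D : 'I_m -> vector_field G) (Delta : G -> R).
Context (k : G -> G -> R) (H : rkhs k).

(* The value is 0 where p = 0 and also, by the convention of [vf_apply], at the
   (negligible) points where a locally Lipschitz p is not derivable along D^l. *)
Definition Dlog (l : 'I_m) (p : G -> R) (x : G) : R :=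
  if p x == 0 then 0 else vf_apply (D l) (fun y => ln (p y)) x.

Definition stein1 (l : 'I_m) (p h : G -> R) (x : G) : R :=
  vf_apply (D l) h x + h x * Dlog l p x + h x * Dlog l Delta x.

Definition stein (p : G -> R) (f : 'I_m -> G -> R) (x : G) : R :=
  \sum_l stein1 l p (f l) x.

Definition KSD (p q : G -> R) : \bar R :=
  ereal_sup [set (\int[mu]_x (stein p f x * q x)%:E)%E
    | f in [set f : 'I_m -> G -> R |
        (forall l, rkhs_carrier H (f l)) /\ \sum_l rkhs_ip H (f l) (f l) <= 1]].

(* The operator acts on the first argument of [k]. *)
Definition stein_section (l : 'I_m) (p : G -> R) (x : G) : G -> R :=
  fun z => stein1 l p (k^~ z) x.

Definition stein_kernel (p : G -> R) (x y : G) : R :=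
  \sum_l rkhs_ip H (stein_section l p x) (stein_section l p y).

Definition weighted_kernel (q w p : G -> R) (x y : G) : R :=
  stein_kernel p x y * q x * q y * (w x)^-1 * (w y)^-1.

Definition wKSD (q w : G -> R) (n : nat) (x : nat -> G) (p : G -> R) : R :=
  Num.sqrt ((n%:R ^+ 2)^-1 *
    \sum_(i < n) \sum_(j < n) weighted_kernel q w p (x i) (x j)).

End Stein.

Definition mutually_independent (R : realType) (d : measure_display)
    (Omega : measurableType d) (P : probability Omega R)
    (d' : measure_display) (T : measurableType d')
    (X : nat -> {RV P >-> T}) : Prop :=
  forall (J : seq nat) (A : nat -> set T), uniq J ->
    (forall i, measurable (A i)) ->
    P (\bigcap_(i in [set` J]) X i @^-1` A i) =
    (\prod_(i <- J) P (X i @^-1` A i))%E.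

Definition iid_samples (R : realType) (d : measure_display)
    (Omega : measurableType d) (P : probability Omega R)
    (m : nat) (G : lieGroupType R m)
    (mu : {measure set (borel G) -> \bar R}) (w : G -> R)
    (X : nat -> {RV P >-> borel G}) : Prop :=
  mutually_independent X /\
  (forall i (A : set (borel G)), measurable A ->
     distribution P (X i) A = (\int[mu]_(x in A) (w x)%:E)%E).

Definition argmin (T : Type) (disp : Order.disp_t) (S : porderType disp)
    (A : set T) (F : T -> S) : set T :=
  [set t | A t /\ forall t', A t' -> (F t <= F t')%O].

(* [pr] and [mk] are mutually inverse homeomorphisms between [Theta] and the
   subspace [setT `*` Theta2] of the product space; [mk] is arbitrary outside
   of it. *)
Definition is_product (R : realType) (Theta : metricType R)
    (Theta1 : topologicalType) (N : nat) (Theta2 : set 'rV[R]_N)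
    (pr : Theta -> Theta1 * 'rV[R]_N) (mk : Theta1 * 'rV[R]_N -> Theta) :
    Prop :=
  [/\ forall t, Theta2 (pr t).2 /\ mk (pr t) = t,
      forall z, Theta2 z.2 -> pr (mk z) = z,
      continuous pr
    & {within [set: Theta1] `*` Theta2, continuous mk}].

Definition edist_set (R : realType) (Theta : metricType R) (t : Theta)
    (A : set Theta) : \bar R :=
  ereal_inf [set (mdist t s)%:E | s in A].

(* Main.v *)
Require Import Defs.
From HB Require Import structures.
From mathcomp Require Import all_boot all_order all_algebra.
From mathcomp Require Import all_classical all_reals all_analysis.
From mathcomp Require Import measurable_realfun.
From mathcomp Require Import ring lra zify.
Import Order.TTheory GRing.Theory Num.Theory.
Import numFieldNormedType.Exports.
Local Open Scope classical_set_scope.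
Local Open Scope ring_scope.

(** The proof rests on one observation: both discrepancies are norms of means of
    one feature map.  Differentiation at a point of the group is represented by
    a vector of the reproducing kernel Hilbert space ([kernel_derivative]), so
    the Stein operator applied to [f] at [x] is the inner product of [f] with a
    Stein feature of [x] in the product space.  With the features rescaled by
    [q / w], [V] is their Gram function, the weighted empirical discrepancy is
    the norm of an empirical mean, and the discrepancy itself is the dual norm
    of the functional that integrates against the law of the samples
    ([wKSD_empirical], [KSD_mean_embedding]).

    The empirical discrepancy converges almost surely, uniformly on compact sets
    of parameters ([uniform_law]).  Joint continuity of [V] bounds the
    oscillation of the features in [x] uniformly over a compact set of
    parameters, so that up to a small error the feature map is a step function
    on finitely many cells, plus a tail controlled by the square-integrable
    envelope given by the supremum of [V].  It is then enough that the
    frequencies of the cells and the empirical average of the envelope on the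
    tail converge, which is the strong law of large numbers for nonnegative
    variables with finite second moment ([strong_law]).

    What remains is deterministic.  The limit inherits continuity on compact sets
    and convexity in the second coordinate.  Since its minimizers over each
    slice form a compact subset of the interior, it exceeds its minimum by a
    margin on the boundary of a compact neighbourhood of them; a convex function
    that is uniformly close to it on that neighbourhood also rises towards the
    boundary, hence is larger everywhere outside.  Compactness of the first
    factor makes the neighbourhood and the margin uniform
    ([convex_localization]).  All minimizations therefore take place on one
    compact set, where uniform convergence forces the minimizers to approach
    those of the limit ([argmin_convergence]). *)

Set Implicit Arguments.
Unset Strict Implicit.

(** * Semi-inner products *)

(** The domain is a predicate because a reproducing kernel Hilbert space is a
    set of functions whose inner product means nothing outside of it. *)
Record semi_inner (R : realType) (E : lmodType R) := SemiInner {
  si_dom : set E;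
  si_ip : E -> E -> R;
  si_dom0 : si_dom 0;
  si_domP : forall (a : R) f g, si_dom f -> si_dom g -> si_dom (a *: f + g);
  si_ipP : forall (a : R) f g h, si_dom f -> si_dom g -> si_dom h ->
    si_ip (a *: f + g) h = a * si_ip f h + si_ip g h;
  si_ipC : forall f g, si_dom f -> si_dom g -> si_ip f g = si_ip g f;
  si_ip_ge0 : forall f, si_dom f -> 0 <= si_ip f f }.

Section SemiInner.
Context (R : realType) (E : lmodType R) (H : semi_inner E).
Local Notation dom := (si_dom H).
Local Notation ip := (si_ip H).
Implicit Types (f g h : E) (a : R).

Definition si_norm f : R := Num.sqrt (ip f f).

Lemma si_domZ a f : dom f -> dom (a *: f).
Proof. by move=> df; rewrite -[_ *: _]addr0; apply: si_domP => //; exact: si_dom0. Qed.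

Lemma si_domD f g : dom f -> dom g -> dom (f + g).
Proof. by move=> df dg; rewrite -[f]scale1r; exact: si_domP. Qed.

Lemma si_domB f g : dom f -> dom g -> dom (f - g).
Proof. by move=> df dg; rewrite addrC -scaleN1r; exact: si_domP. Qed.

Lemma si_dom_sum (I : Type) (r : seq I) (P : pred I) (F : I -> E) :
  (forall i, P i -> dom (F i)) -> dom (\sum_(i <- r | P i) F i).
Proof.
move=> dF; elim/big_ind : _ => //; first exact: si_dom0.
by move=> f g; exact: si_domD.
Qed.

Lemma si_ip0l h : dom h -> ip 0 h = 0.
Proof.
move=> dh; have d0 := si_dom0 H.
have := si_ipP 1 d0 d0 dh; rewrite scaler0 add0r mul1r => /eqP.
by rewrite -subr_eq0 opprD addNKr oppr_eq0 => /eqP.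
Qed.

Lemma si_ipZl a f h : dom f -> dom h -> ip (a *: f) h = a * ip f h.
Proof.
move=> df dh; rewrite -[a *: f]addr0 si_ipP//; last exact: si_dom0.
by rewrite si_ip0l// addr0.
Qed.

Lemma si_ipDl f g h : dom f -> dom g -> dom h -> ip (f + g) h = ip f h + ip g h.
Proof. by move=> df dg dh; rewrite -[f in LHS]scale1r si_ipP// mul1r. Qed.

Lemma si_ipBl f g h : dom f -> dom g -> dom h -> ip (f - g) h = ip f h - ip g h.
Proof. by move=> df dg dh; rewrite addrC -scaleN1r si_ipP// mulN1r addrC. Qed.

Lemma si_ipZr a f h : dom f -> dom h -> ip f (a *: h) = a * ip f h.
Proof. by move=> df dh; rewrite si_ipC ?si_ipZl 1?si_ipC//; exact: si_domZ. Qed.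

Lemma si_ipDr f g h : dom f -> dom g -> dom h -> ip f (g + h) = ip f g + ip f h.
Proof.
move=> df dg dh; rewrite si_ipC ?si_ipDl//; last exact: si_domD.
by rewrite !(si_ipC _ df).
Qed.

Lemma si_ipBr f g h : dom f -> dom g -> dom h -> ip f (g - h) = ip f g - ip f h.
Proof.
move=> df dg dh; rewrite si_ipC ?si_ipBl//; last exact: si_domB.
by rewrite !(si_ipC _ df).
Qed.

Lemma si_ip_suml (I : Type) (r : seq I) (F : I -> E) h :
  (forall i, dom (F i)) -> dom h ->
  ip (\sum_(i <- r) F i) h = \sum_(i <- r) ip (F i) h.
Proof.
move=> dF dh; elim: r => [|i r IHr]; first by rewrite !big_nil si_ip0l.
by rewrite !big_cons si_ipDl// ?IHr//; exact: si_dom_sum.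
Qed.

Lemma si_ip_sumr (I : Type) (r : seq I) (F : I -> E) h :
  (forall i, dom (F i)) -> dom h ->
  ip h (\sum_(i <- r) F i) = \sum_(i <- r) ip h (F i).
Proof.
move=> dF dh; rewrite si_ipC// ?si_ip_suml//; last exact: si_dom_sum.
by apply: eq_bigr => i _; rewrite si_ipC.
Qed.

Lemma si_norm_ge0 f : 0 <= si_norm f. Proof. exact: sqrtr_ge0. Qed.

Lemma sqr_si_norm f : dom f -> si_norm f ^+ 2 = ip f f.
Proof. by move=> df; rewrite sqr_sqrtr// si_ip_ge0. Qed.

Lemma si_normZ a f : dom f -> si_norm (a *: f) = `|a| * si_norm f.
Proof.
move=> df; have dZ := si_domZ a df.
by rewrite /si_norm si_ipZl// si_ipZr// mulrA -expr2 sqrtrM ?sqr_ge0// sqrtr_sqr.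
Qed.

Lemma si_sqr_normB f g : dom f -> dom g ->
  ip (f - g) (f - g) = ip f f - 2 * ip f g + ip g g.
Proof.
move=> df dg; have dB := si_domB df dg.
by rewrite si_ipBl// !si_ipBr// (si_ipC dg df); ring.
Qed.

(** Nonnegativity of [|a f - b g|^2] for all [a] and [b] leaves the quadratic
    form no choice; when [|g| = 0] it is affine in [b], and a suitable [b] would
    make it negative unless [<f, g> = 0]. *)
Lemma si_cauchy_schwarz f g : dom f -> dom g ->
  `|ip f g| <= si_norm f * si_norm g.
Proof.
move=> df dg.
have key a b : 0 <= a ^+ 2 * ip f f - 2 * (a * b) * ip f g + b ^+ 2 * ip g g.
  have da := si_domZ a df; have db := si_domZ b dg.
  have := si_ip_ge0 (si_domB da db).
  by rewrite si_sqr_normB// !(si_ipZl, si_ipZr)//; congr (_ <= _); ring.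
rewrite -ler_sqr ?nnegrE ?mulr_ge0 ?si_norm_ge0//.
rewrite exprMn !sqr_si_norm// -normrX ger0_norm ?sqr_ge0//.
have := si_ip_ge0 dg; rewrite le_eqVlt => /predU1P[g0|g0].
  have [->|fg0] := eqVneq (ip f g) 0.
    by rewrite expr0n/= mulr_ge0// si_ip_ge0.
  have := key 1 ((ip f f + 1) / (2 * ip f g)).
  rewrite -g0 mulr0 addr0 expr1n !mul1r.
  rewrite [X in _ - X](_ : _ = ip f f + 1); last by field.
  lra.
have := key (ip g g) (ip f g).
rewrite [leRHS](_ : _ = ip g g * (ip f f * ip g g - ip f g ^+ 2)); last by ring.
by rewrite pmulr_rge0// subr_ge0.
Qed.

Lemma ler_si_normD f g : dom f -> dom g -> si_norm (f + g) <= si_norm f + si_norm g.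
Proof.
move=> df dg; have dfg := si_domD df dg.
rewrite -ler_sqr ?nnegrE ?addr_ge0 ?si_norm_ge0// sqrrD !sqr_si_norm//.
rewrite si_ipDl// !si_ipDr// (si_ipC dg df).
have := ler_norm (ip f g); have := si_cauchy_schwarz df dg.
set u := si_norm f * si_norm g; lra.
Qed.

Lemma si_normN f : dom f -> si_norm (- f) = si_norm f.
Proof. by move=> df; rewrite -scaleN1r si_normZ// normrN1 mul1r. Qed.

Lemma ler_si_norm_sum (I : Type) (r : seq I) (F : I -> E) :
  (forall i, dom (F i)) -> si_norm (\sum_(i <- r) F i) <= \sum_(i <- r) si_norm (F i).
Proof.
move=> dF; elim: r => [|i r IHr].
  by rewrite !big_nil /si_norm si_ip0l ?sqrtr0//; exact: si_dom0.
rewrite !big_cons; apply: le_trans (ler_si_normD _ _) _ => //.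
  exact: si_dom_sum.
by rewrite lerD2l.
Qed.

Lemma ler_dist_si_norm f g : dom f -> dom g ->
  `|si_norm f - si_norm g| <= si_norm (f - g).
Proof.
move=> df dg; have dB := si_domB df dg.
have := ler_si_normD dB dg; rewrite subrK.
have dB' := si_domB dg df; have := ler_si_normD dB' df; rewrite subrK.
by rewrite -[g - f]opprB si_normN// ler_norml; lra.
Qed.

(** The norm is the supremum of [<f, v>] over the unit ball, attained at
    [v / |v|]; hence a functional uniformly close to [<., v>] on the ball has a
    supremum close to [|v|].  This computes the dual norm of a functional from
    approximate representing vectors, without producing an exact one. *)
Lemma ereal_sup_si_norm (I : E -> \bar R) (v : E) (e : R) : dom v ->
  (forall f, dom f -> ip f f <= 1 ->
     ((ip f v - e)%:E <= I f)%E /\ (I f <= (ip f v + e)%:E)%E) ->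
  exists2 c : R, ereal_sup [set I f | f in [set f | dom f /\ ip f f <= 1]] = c%:E
    & `|c - si_norm v| <= e.
Proof.
move=> dv hI; set S := [set _ | _ in _].
have le1 : (ereal_sup S <= (si_norm v + e)%:E)%E.
  apply: ge_ereal_sup => _ [f [df f1] <-].
  have [_ /le_trans] := hI f df f1; apply; rewrite lee_fin lerD2r.
  apply: le_trans (ler_norm _) _; apply: le_trans (si_cauchy_schwarz df dv) _.
  rewrite -[leRHS]mul1r ler_wpM2r ?si_norm_ge0//.
  by rewrite -sqrtr1 ler_wsqrtr.
have le2 : ((si_norm v - e)%:E <= ereal_sup S)%E.
  have [v0|v0] := eqVneq (si_norm v) 0.
    have d0 := si_dom0 H.
    have ip00 : ip 0 0 <= 1 by rewrite si_ip0l.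
    have [le0 _] := hI 0 d0 ip00.
    apply: (@le_trans _ _ (I 0)).
      by move: le0; rewrite si_ip0l// v0.
    by apply: ereal_sup_ubound; exists 0.
  have du := si_domZ (si_norm v)^-1 dv.
  have u1 : ip ((si_norm v)^-1 *: v) ((si_norm v)^-1 *: v) = 1.
    by rewrite si_ipZl// si_ipZr// -(sqr_si_norm dv); field.
  have uv : ip ((si_norm v)^-1 *: v) v = si_norm v.
    by rewrite si_ipZl// -(sqr_si_norm dv); field.
  have u1' : ip ((si_norm v)^-1 *: v) ((si_norm v)^-1 *: v) <= 1 by rewrite u1.
  have [leu _] := hI _ du u1'.
  rewrite uv in leu; apply: le_trans leu _.
  by apply: ereal_sup_ubound; eexists; [split; [exact: du|]|].
have fS : ereal_sup S \is a fin_num.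
  by rewrite fin_real// (lt_le_trans _ le2) ?ltNyr//= (le_lt_trans le1) ?ltry.
exists (fine (ereal_sup S)); first by rewrite fineK.
move: le1 le2; rewrite -(fineK fS) !lee_fin /= => le1 le2.
by rewrite ler_norml; lra.
Qed.

End SemiInner.

(** * A strong law of large numbers *)

Section StrongLaw.
Context (R : realType) (d : measure_display) (T : measurableType d).

(** The sum of the series is integrable, hence almost everywhere finite, and the
    terms of a convergent series vanish. *)
Lemma ae_cvg0_summable (mu : {measure set T -> \bar R}) (f : nat -> T -> R) (C : R) :
  (forall n, measurable_fun setT (f n)) -> (forall n x, 0 <= f n x) ->
  (forall n, (\sum_(k < n) \int[mu]_x (f k x)%:E <= C%:E)%E) ->
  {ae mu, forall x, f ^~ x @ \oo --> (0 : R)}.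
Proof.
move=> mf f0 fC.
pose F : T -> \bar R := fun x => (\sum_(k <oo) (f k x)%:E)%E.
have mEf n : measurable_fun setT (EFin \o f n) by exact/measurable_EFinP.
have Ef0 n x : (0 <= (f n x)%:E)%E by rewrite lee_fin.
have iF : (\int[mu]_x F x <= C%:E)%E.
  rewrite integral_nneseries//.
  apply: lime_le; first by apply: is_cvg_nneseries => n _ _; exact: integral_ge0.
  by apply: nearW => n; rewrite big_mkord.
have F0 x : (0 <= F x)%E by exact: nneseries_ge0.
have iiF : mu.-integrable setT F.
  apply/integrableP; split.
    apply: (@ge0_emeasurable_sum _ _ _ _ (fun n x => (f n x)%:E) xpredT) => [k x _ _|k _].
      exact: Ef0.
    exact: mEf.
  under eq_integral do rewrite gee0_abs//.
  exact: le_lt_trans iF (ltry _).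
have := integrable_ae measurableT iiF; apply: filterS => x /(_ I) Fx.
apply: cvg_series_cvg_0; apply: nondecreasing_is_cvgn.
  by apply/nondecreasing_seqP => n; rewrite seriesSr lerDl.
exists (fine (F x)) => _ [n _ <-]; rewrite -lee_fin fineK// /series/= -sumEFin.
exact: nneseries_lim_ge.
Qed.

(** The induction proves the sharper bound [2 - 1 / n], by comparison with the
    telescoping sum of [1 / (k (k + 1))]. *)
Lemma sum_inv_sqr_le2 n : \sum_(k < n) (k.+1%:R ^+ 2 : R)^-1 <= 2.
Proof.
suff : \sum_(k < n.+1) (k.+1%:R ^+ 2 : R)^-1 <= 2 - n.+1%:R^-1.
  rewrite big_ord_recr/= => h; apply: le_trans (le_trans h _).
    by rewrite lerDl invr_ge0 sqr_ge0.
  by rewrite gerBl invr_ge0.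
elim: n => [|n IHn]; first by rewrite big_ord1 expr1n invr1; lra.
rewrite big_ord_recr/=; apply: le_trans (lerD IHn (lexx _)) _.
rewrite -subr_ge0 -[n.+2]addn1 natrD; set a : R := n.+1%:R.
have a0 : 0 < a by rewrite /a.
rewrite (_ : _ - _ = (a * (a + 1) ^+ 2)^-1); last by field; lra.
by rewrite invr_ge0 mulr_ge0 ?sqr_ge0// ltW.
Qed.

(** Between consecutive squares a nondecreasing sequence cannot move much
    relative to the index, since [(k + 1)^2 / k^2] tends to [1]. *)
Lemma cvg_mean_squares (S : nat -> R) (m : R) :
  nondecreasing_seq S -> (forall n, 0 <= S n) ->
  (fun k => S (k.+1 ^ 2)%N / (k.+1 ^ 2)%:R) @ \oo --> m ->
  (fun n => S n / n%:R) @ \oo --> m.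
Proof.
move=> Snd S0 Sm.
have ratio : (fun k : nat => (k.+1%:R / k.+2%:R : R)) @ \oo --> (1 : R).
  rewrite (_ : (fun _ => _) = fun k => 1 - k.+2%:R^-1); last first.
    apply/funext => k; rewrite -[k.+2]addn1 natrD.
    have a0 : 0 < k.+1%:R :> R by rewrite ltr0n.
    by field; lra.
  rewrite -[X in _ --> X]subr0; apply: cvgB; first exact: cvg_cst.
  by have := @cvg_harmonic R; rewrite -cvg_shiftS.
have ratio2 : (fun k : nat => (k.+1%:R / k.+2%:R : R) ^+ 2) @ \oo --> (1 : R).
  by rewrite -[X in _ --> X]mulr1; apply: cvgM.
have low : (fun k => S (k.+1 ^ 2)%N / (k.+2 ^ 2)%:R) @ \oo --> m.
  rewrite (_ : (fun _ => _) = fun k =>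
      S (k.+1 ^ 2)%N / (k.+1 ^ 2)%:R * (k.+1%:R / k.+2%:R) ^+ 2); last first.
    apply/funext => k; rewrite !natrX.
    have : k.+1%:R != 0 :> R by rewrite pnatr_eq0.
    have : k.+2%:R != 0 :> R by rewrite pnatr_eq0.
    by move: (k.+1%:R : R) (k.+2%:R : R) => a b b0 a0; field; rewrite a0 b0.
  by rewrite -[X in _ --> X]mulr1; apply: cvgM.
have upp : (fun k => S (k.+2 ^ 2)%N / (k.+1 ^ 2)%:R) @ \oo --> m.
  rewrite (_ : (fun _ => _) = fun k =>
      S (k.+2 ^ 2)%N / (k.+2 ^ 2)%:R * (k.+1%:R / k.+2%:R) ^- 2); last first.
    apply/funext => k; rewrite !natrX.
    have : k.+1%:R != 0 :> R by rewrite pnatr_eq0.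
    have : k.+2%:R != 0 :> R by rewrite pnatr_eq0.
    by move: (k.+1%:R : R) (k.+2%:R : R) => a b b0 a0; field; rewrite a0 b0.
  rewrite -[X in _ --> X]mulr1 -[X in _ * X]invr1.
  apply: cvgM; first by move: Sm; rewrite -cvg_shiftS.
  by apply: cvgV => //; rewrite oner_neq0.
apply/cvgrPdist_lt => e e0.
move/cvgrPdist_lt : low => /(_ e e0)[N1 _ low].
move/cvgrPdist_lt : upp => /(_ e e0)[N2 _ upp].
exists ((N1 + N2).+1 ^ 2)%N => // n /= Nn.
have [k /andP[kn nk]] : exists k, (k.+1 ^ 2 <= n < k.+2 ^ 2)%N.
  have n0 : (0 < n)%N by apply: leq_trans Nn; rewrite expn_gt0.
  elim: n n0 {Nn} => // -[|n] IHn _; first by exists 0%N.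
  have [k /andP[k1 k2]] := IHn isT.
  have [nk|nk] := ltnP n.+2 (k.+2 ^ 2); first by exists k; rewrite nk ltnW.
  by exists k.+1; rewrite nk/=; move: k2 nk; rewrite !expnS !expn0; nia.
have NNk : (N1 + N2 <= k)%N.
  rewrite leqNgt; apply/negP => kN; move: Nn; apply/negP; rewrite -ltnNge.
  by apply: leq_trans nk _; rewrite leq_exp2r.
have {low} := low k (leq_trans (leq_addr _ _) NNk).
have {upp} := upp k (leq_trans (leq_addl _ _) NNk).
have : (0 < k.+1 ^ 2)%N by rewrite expn_gt0.
move: (k.+1 ^ 2)%N (k.+2 ^ 2)%N kn nk => a b an nb a0.
have n0 : (0 < n)%N by exact: leq_trans an.
have b0 : (0 < b)%N by exact: leq_ltn_trans nb.
have h1 : S a / b%:R <= S n / n%:R.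
  apply: ler_pM; [exact: S0|by rewrite invr_ge0|exact: Snd|].
  by rewrite lef_pV2 ?posrE ?ltr0n// ler_nat ltnW.
have h2 : S n / n%:R <= S b / a%:R.
  apply: ler_pM; [exact: S0|by rewrite invr_ge0|exact: Snd (ltnW nb)|].
  by rewrite lef_pV2 ?posrE ?ltr0n// ler_nat.
rewrite !ltr_distl => /andP[u1 u2] /andP[l1 l2]; apply/andP; split; lra.
Qed.

End StrongLaw.

Section Samples.
Context (R : realType) (d d' : measure_display) (Omega : measurableType d)
  (T : measurableType d') (P : probability Omega R) (X : nat -> {RV P >-> T})
  (Q : probability T R).
Hypothesis Xind : mutually_independent X.
Hypothesis Xlaw : forall i A, measurable A -> distribution P (X i) A = Q A.

Lemma ge0_integral_sample i (f : T -> \bar R) :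
  measurable_fun setT f -> (forall x, 0 <= f x)%E ->
  (\int[P]_x f (X i x) = \int[Q]_x f x)%E.
Proof.
move=> mf f0; rewrite -(ge0_integral_distribution (X i))//.
by apply: eq_measure_integral => A mA _; exact: Xlaw.
Qed.

(** Independence makes the joint law of two samples the product of their laws,
    by uniqueness of the product measure; the rest is Tonelli. *)
Lemma integral_sampleM i j (f : T -> R) : i != j ->
  measurable_fun setT f -> (forall x, 0 <= f x) ->
  (\int[P]_x (f (X i x) * f (X j x))%:E =
   \int[Q]_x (f x)%:E * \int[Q]_x (f x)%:E)%E.
Proof.
move=> ij mf f0.
have mEf : measurable_fun setT (EFin \o f) by exact/measurable_EFinP.
pose h (x : Omega) : T * T := (X i x, X j x).
have mh : measurable_fun setT h by exact: measurable_fun_pair.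
pose Z : {RV P >-> (T * T)%type} := HB.pack h (isMeasurableFun.Build _ _ _ _ _ mh).
pose g (z : T * T) : \bar R := (f z.1 * f z.2)%:E.
have mg : measurable_fun setT g.
  apply/measurable_EFinP; apply: measurable_funM.
    exact: (measurableT_comp mf measurable_fst).
  exact: (measurableT_comp mf measurable_snd).
have g0 z : (0 <= g z)%E by rewrite lee_fin mulr_ge0.
rewrite -[LHS]/(\int[P]_x (g \o Z) x)%E -ge0_integral_distribution//.
have -> : (\int[distribution P Z]_y g y = \int[(Q \x Q)%E]_y g y)%E.
  apply: eq_measure_integral => A mA _; apply/esym; apply: product_measure_unique => //.
  move=> B C mB mC.
  have := Xind (J := [:: i; j]) (A := fun k => if k == i then B else C).
  rewrite /= inE ij => /(_ isT).
  have mBC k : measurable (if k == i then B else C) by case: ifP.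
  move=> /(_ mBC); rewrite big_cons big_seq1 eqxx eq_sym (negbTE ij).
  rewrite -(Xlaw i mB) -(Xlaw j mC) => <-; congr (P _).
  apply/seteqP; split => x.
    move=> [hB hC] k; rewrite /= !inE => /orP[/eqP->|/eqP->]; first by rewrite eqxx.
    by rewrite eq_sym (negbTE ij).
  move=> hx; split => /=.
    by have := hx i; rewrite /= eqxx !inE eqxx; exact.
  by have := hx j; rewrite /= eq_sym (negbTE ij) !inE eqxx orbT; exact.
rewrite fubini_tonelli1// /fubini_F/= /g/=.
under eq_integral do under eq_integral do rewrite EFinM.
under eq_integral => x _.
  rewrite ge0_integralZl//; [|by move=> y _; rewrite lee_fin|by rewrite lee_fin].
  over.
rewrite ge0_integralZr//; first by move=> y _; rewrite lee_fin.
by apply: integral_ge0 => y _; rewrite lee_fin.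
Qed.

(** Second moments suffice: by independence the centred sum of [n] terms has
    second moment at most [n] times a constant, so the normalised squares are
    summable along [n = k^2], and monotonicity fills the gaps. *)
Lemma strong_law (f : T -> R) :
  measurable_fun setT f -> (forall x, 0 <= f x) ->
  (\int[Q]_x (f x ^+ 2)%:E < +oo)%E ->
  exists2 m : R, (\int[Q]_x (f x)%:E)%E = m%:E &
    {ae P, forall x, (fun n => (\sum_(i < n) f (X i x)) / n%:R) @ \oo --> m}.
Proof.
move=> mf f0 f2.
have f2_ge0 : (0 <= \int[Q]_x (f x ^+ 2)%:E)%E.
  by apply: integral_ge0 => x _; rewrite lee_fin sqr_ge0.
have mf2 : measurable_fun setT (fun x => f x ^+ 2) by exact: measurable_funX.
pose v := fine (\int[Q]_x (f x ^+ 2)%:E).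
have vE : (\int[Q]_x (f x ^+ 2)%:E)%E = v%:E by rewrite fineK// ge0_fin_numE.
pose Y i x := f (X i x).
have mY i : measurable_fun setT (Y i) by exact: measurableT_comp.
have iYY i j : P.-integrable setT (EFin \o (fun x => Y i x * Y j x)).
  have mYY k : measurable_fun setT (fun x => Y k x ^+ 2) by exact: measurable_funX.
  have iY2 k : P.-integrable setT (EFin \o (fun x => Y k x ^+ 2)).
    apply/integrableP; split; first exact/measurable_EFinP.
    under eq_integral do rewrite /= ger0_norm ?sqr_ge0//.
    rewrite (@ge0_integral_sample k (fun x => (f x ^+ 2)%:E))//.
      exact/measurable_EFinP.
    by move=> x; rewrite lee_fin sqr_ge0.
  apply: (@le_integrable _ _ _ P _ measurableT _
    (fun x => (Y i x ^+ 2)%:E + (Y j x ^+ 2)%:E)%E).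
  - by apply/measurable_EFinP; exact: measurable_funM.
  - move=> x _ /=; rewrite lee_fin !ger0_norm ?addr_ge0 ?sqr_ge0 ?mulr_ge0 ?f0//.
    have := sqr_ge0 (Y i x - Y j x); have := f0 (X i x); have := f0 (X j x).
    by rewrite -/(Y i x) -/(Y j x); nra.
  - exact: (integrableD measurableT (iY2 i) (iY2 j)).
have c1 : P.-integrable setT (EFin \o (fun _ : Omega => 1 : R)).
  exact: finite_measure_integrable_cst.
have iY i : P.-integrable setT (EFin \o Y i).
  apply: (@le_integrable _ _ _ P _ measurableT _
    (fun x => (Y i x * Y i x)%:E + 1%:E)%E).
  - exact/measurable_EFinP.
  - move=> x _ /=; rewrite lee_fin !ger0_norm ?addr_ge0 ?sqr_ge0 ?mulr_ge0 ?f0//.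
    by have := sqr_ge0 (Y i x - 1); have := f0 (X i x); rewrite -/(Y i x); nra.
  - exact: (integrableD measurableT (iYY i i) c1).
have EY i : (\int[P]_x (EFin \o Y i) x = \int[Q]_x (f x)%:E)%E.
  by rewrite -(@ge0_integral_sample i (EFin \o f))//; exact/measurable_EFinP.
pose m := fine (\int[Q]_x (f x)%:E).
have mE : (\int[Q]_x (f x)%:E)%E = m%:E.
  by rewrite fineK// -(EY 0%N); exact: (integrable_fin_num measurableT (iY 0%N)).
exists m => //.
have EYY i : (\int[P]_x (Y i x * Y i x)%:E = v%:E)%E.
  rewrite -vE -(@ge0_integral_sample i (fun x => (f x ^+ 2)%:E))//.
    exact/measurable_EFinP.
  by move=> x; rewrite lee_fin sqr_ge0.
have EYYn i j : i != j -> (\int[P]_x (Y i x * Y j x)%:E = (m ^+ 2)%:E)%E.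
  by move=> ij; rewrite integral_sampleM// mE EFinM.
(* The centred variables [Z i] are uncorrelated. *)
pose Z i x := Y i x - m.
have ZZE i j : EFin \o (fun x => Z i x * Z j x) = (fun x =>
   ((EFin \o (fun x => (Y i x * Y j x)%R)) x - m%:E * (EFin \o Y i) x) -
   (m%:E * (EFin \o Y j) x - (m ^+ 2)%:E * (EFin \o (fun=> 1%R : R)) x))%E.
  by apply/funext => x /=; congr EFin; rewrite /Z; ring.
have iZ1 i j : P.-integrable setT
    (fun x => ((EFin \o (fun x => (Y i x * Y j x)%R)) x - m%:E * (EFin \o Y i) x))%E.
  by apply: integrableB => //; exact: integrableZl.
have iZ2 j : P.-integrable setT
    (fun x => (m%:E * (EFin \o Y j) x - (m ^+ 2)%:E * (EFin \o (fun=> 1%R : R)) x))%E.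
  by apply: integrableB => //; exact: integrableZl.
have iZZ i j : P.-integrable setT (EFin \o (fun x => Z i x * Z j x)).
  by rewrite ZZE; exact: integrableB.
have EZZ i j : (\int[P]_x (Z i x * Z j x)%:E =
    \int[P]_x (Y i x * Y j x)%:E - (m ^+ 2)%:E)%E.
  rewrite -[LHS]/(\int[P]_x (EFin \o (fun x => (Z i x * Z j x)%R)) x)%E ZZE.
  rewrite integralB// integralB//; last exact: integrableZl.
  rewrite integralB//; [|exact: integrableZl|exact: integrableZl].
  rewrite !integralZl// !EY mE [X in (_ - (_ - _ * X))%E](_ : _ = 1%E); last first.
    by have := integral_cst P measurableT 1%:E; rewrite mul1e => ->; exact: probability_setT.
  have := integrable_fin_num measurableT (iYY i j).
  rewrite /=; case: (integral _ _ _) => // r _.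
  by congr EFin; ring.
have ESn n : (\int[P]_x ((\sum_(i < n) Z i x) ^+ 2)%:E <= (n%:R * v)%:E)%E.
  have -> : (fun x => ((\sum_(i < n) Z i x)%R ^+ 2)%:E)%E = (fun x =>
      \sum_(i < n) \sum_(j < n) (EFin \o (fun x => (Z i x * Z j x)%R)) x)%E.
    apply/funext => x; rewrite expr2 mulr_suml -sumEFin.
    by apply: eq_bigr => i _; rewrite mulr_sumr -sumEFin.
  rewrite integral_sum//; last by move=> i; exact: integrable_sum.
  under eq_bigr do rewrite integral_sum//.
  have -> : (n%:R * v)%:E = (\sum_(i < n) v%:E)%E.
    by rewrite sumEFin sumr_const card_ord mulr_natl.
  apply: lee_sum => i _; rewrite (bigD1 i)//= big1 ?adde0.
    by rewrite EZZ EYY -EFinB lee_fin gerBl sqr_ge0.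
  by move=> j ji; rewrite EZZ EYYn 1?eq_sym// subee.
have mZ i : measurable_fun setT (Z i) by apply: measurable_funB.
have := @ae_cvg0_summable _ _ _ P
  (fun k x => ((\sum_(i < k.+1 ^ 2) Z i x) / (k.+1 ^ 2)%:R) ^+ 2) (2 * v).
have v0 : 0 <= v by rewrite fine_ge0.
have mS n : measurable_fun setT (fun x => \sum_(i < n) Z i x).
  by apply: measurable_sum.
have mSk k : measurable_fun setT
    (fun x => ((\sum_(i < k.+1 ^ 2) Z i x) / (k.+1 ^ 2)%:R) ^+ 2).
  by apply: measurable_funX; apply: measurable_funM.
move=> /(_ mSk (fun _ _ => sqr_ge0 _)).
have bound n : (\sum_(k < n)
    \int[P]_x (((\sum_(i < k.+1 ^ 2) Z i x) / (k.+1 ^ 2)%:R) ^+ 2)%:E <= (2 * v)%:E)%E.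
  apply: (@le_trans _ _ (\sum_(k < n) ((k.+1%:R ^+ 2)^-1 * v)%:E)%E).
    apply: lee_sum => k _.
    under eq_integral do rewrite exprMn mulrC EFinM.
    rewrite ge0_integralZl//; first last.
    - by move=> x _; rewrite lee_fin sqr_ge0.
    - by apply/measurable_EFinP; apply: measurable_funX; exact: mS.
    apply: le_trans (lee_wpmul2l _ (ESn _)) _; first by rewrite lee_fin sqr_ge0.
    rewrite -EFinM lee_fin le_eqVlt; apply/orP; left; apply/eqP.
    rewrite natrX; have : k.+1%:R != 0 :> R by rewrite pnatr_eq0.
    by move: (k.+1%:R : R) => a a0; field.
  by rewrite sumEFin lee_fin -mulr_suml ler_wpM2r// sum_inv_sqr_le2.
move=> /(_ bound); apply: filterS => x hx.
apply: (@cvg_mean_squares _ (fun n => \sum_(i < n) Y i x)).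
- by apply/nondecreasing_seqP => n; rewrite big_ord_recr lerDl f0.
- by move=> n; apply: sumr_ge0 => i _; exact: f0.
apply/cvgrPdist_lt => e e0.
move/cvgrPdist_lt : hx => /(_ (e ^+ 2)); rewrite exprn_gt0// => /(_ isT).
apply: filterS => k; rewrite sub0r normrN normrX.
rewrite ltr_sqr ?nnegrE ?normr_ge0 ?ltW// distrC; congr (`|_| < _).
rewrite [in LHS]/Z sumrB sumr_const card_ord mulrBl; congr (_ - _).
by rewrite -(mulr_natr m) mulfK// pnatr_eq0 expn_eq0.
Qed.

End Samples.

(** * Feature maps with jointly continuous Gram functions *)

Lemma continuous_borel_measurable (R : realType) (G : ptopologicalType) (f : G -> R) :
  continuous f -> measurable_fun [set: borel G] (f : borel G -> R).
Proof.
move=> cf; apply: (measurability _ (RGenOInfty.measurableE R)) => _ [_ [x ->] <-].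
rewrite setTI; apply: sub_sigma_algebra.
by apply: (open_comp (fun y _ => cf y)); exact: interval_open.
Qed.

Section FeatureMaps.
Context (R : realType) (E : lmodType R) (H : semi_inner E)
  (Theta : topologicalType) (G : ptopologicalType) (phi : Theta -> G -> E).
Local Notation dom := (si_dom H).
Local Notation ip := (si_ip H).
Local Notation nrm := (si_norm H).
Hypothesis dphi : forall t x, dom (phi t x).
Hypothesis phi_cont :
  continuous (fun z : Theta * (G * G) => ip (phi z.1 z.2.1) (phi z.1 z.2.2) : R^o).

Lemma ip_feature_cvg (I : Type) (F : set_system I) (t : I -> Theta) (x y : I -> G)
    (t0 : Theta) (x0 y0 : G) : Filter F ->
  t @ F --> t0 -> x @ F --> x0 -> y @ F --> y0 ->
  (fun i => ip (phi (t i) (x i)) (phi (t i) (y i))) @ F --> ip (phi t0 x0) (phi t0 y0).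
Proof.
move=> FF ct cx cy.
have h := @phi_cont (t0, (x0, y0)).
have cz : (fun i => (t i, (x i, y i))) @ F --> (t0, (x0, y0)).
  exact: (cvg_pair ct (cvg_pair cx cy)).
exact: (cvg_comp _ _ cz h).
Qed.

(** The squared distance of two feature vectors at one parameter is a combination
    of three inner products at that parameter. *)
Lemma feature_dist_cvg (I : Type) (F : set_system I) (t : I -> Theta) (x y : I -> G)
    (t0 : Theta) (x0 : G) : Filter F ->
  t @ F --> t0 -> x @ F --> x0 -> y @ F --> x0 ->
  (fun i => nrm (phi (t i) (x i) - phi (t i) (y i))) @ F --> (0 : R).
Proof.
move=> FF ct cx cy; rewrite -(@sqrtr0 R).
suff h : (fun i => ip (phi (t i) (x i) - phi (t i) (y i))
                       (phi (t i) (x i) - phi (t i) (y i))) @ F --> (0 : R).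
  exact: (cvg_comp _ _ h (@sqrt_continuous R 0)).
rewrite [X in X @ _](_ : _ = (fun i => ip (phi (t i) (x i)) (phi (t i) (x i)) -
     2 * ip (phi (t i) (x i)) (phi (t i) (y i)) +
     ip (phi (t i) (y i)) (phi (t i) (y i)))); last first.
  by apply/funext => i; rewrite si_sqr_normB.
rewrite [X in _ --> X](_ : 0 = ip (phi t0 x0) (phi t0 x0) -
  2 * ip (phi t0 x0) (phi t0 x0) + ip (phi t0 x0) (phi t0 x0)); last by ring.
apply: cvgD; last exact: ip_feature_cvg.
apply: cvgB; first exact: ip_feature_cvg.
by apply: cvgM; [exact: cvg_cst|exact: ip_feature_cvg].
Qed.

Lemma feature_coord_continuous (t : Theta) (f : E) : dom f ->
  continuous (fun x => ip f (phi t x)).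
Proof.
move=> df x; apply/cvgrPdist_lt => e e0.
pose c := nrm f + 1; have c0 : 0 < c by rewrite ltr_wpDl// si_norm_ge0.
have : (fun y => nrm (phi t x - phi t y)) @ x --> (0 : R).
  exact: (@feature_dist_cvg _ (nbhs x) (fun=> t) (fun=> x) id t x _
    (cvg_cst _) (cvg_cst _) (@cvg_id _ _)).
move=> /cvgrPdist_lt /(_ (e / c) (divr_gt0 e0 c0)); apply: filterS => y.
rewrite sub0r normrN ger0_norm ?si_norm_ge0// => h.
rewrite -si_ipBr//; apply: le_lt_trans (si_cauchy_schwarz df _) _.
  exact: si_domB.
apply: (@le_lt_trans _ _ (c * nrm (phi t x - phi t y))).
  by rewrite ler_wpM2r ?si_norm_ge0// lerDl.
by rewrite mulrC -ltr_pdivlMr.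
Qed.

(** Tube lemma.  The hypothesis controls inner products at one parameter only,
    so [phi t x] itself may jump with [t]; its increments in [x] cannot, and
    compactness makes their smallness uniform. *)
Lemma feature_equicontinuous (K : set Theta) (b : G) (e : R) :
  compact K -> 0 < e ->
  \forall x \near b, forall t, K t -> nrm (phi t x - phi t b) < e.
Proof.
move=> /compact_near_coveringP cK e0.
apply: (cK _ _ (fun x t => nrm (phi t x - phi t b) < e)) => t Kt.
have : (fun z : Theta * G => nrm (phi z.1 z.2 - phi z.1 b)) @ (t, b) --> (0 : R).
  exact: (@feature_dist_cvg _ (nbhs (t, b)) fst snd (fun=> b) t b _
    cvg_fst cvg_snd (cvg_cst _)).
move=> /cvgrPdist_lt /(_ e e0); apply: filterS => -[t' x] /=.
by rewrite sub0r normrN ger0_norm ?si_norm_ge0.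
Qed.

(** Countably many basic open sets on which the feature maps oscillate little
    cover the space, by second countability; they are then made disjoint. *)
Lemma feature_partition (K : set Theta) (e : R) :
  @second_countable G -> compact K -> 0 < e ->
  exists (B : nat -> set (borel G)) (b : nat -> G),
    [/\ forall i, measurable (B i), trivIset setT B, \bigcup_i B i = setT &
        forall i x t, B i x -> K t -> nrm (phi t x - phi t (b i)) <= e].
Proof.
move=> [BB cBB [oBB bBB]] cK e0.
pose ok (U : set G) b := forall x t, U x -> K t -> nrm (phi t x - phi t b) <= e.
pose CC := [set U : set G | BB U /\ exists b, ok U b].
have cover x : exists2 U, CC U & U x.
  have : nbhs x [set y | forall t, K t -> nrm (phi t y - phi t x) < e].
    exact: feature_equicontinuous.
  move=> /(bBB x)[U [BU Ux] hU]; exists U => //; split => //.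
  by exists x => y t Uy Kt; apply/ltW; exact: hU.
have cCC : countable CC.
  by apply: sub_countable cBB; apply: subset_card_le => U [].
have CC0 : CC !=set0 by have [U CU _] := cover point; exists U.
have /pfcard_geP[CC_eq0|[f]] := cCC.
  by move: CC0; rewrite CC_eq0 => -[].
have fCC i : CC (f i) by exact: funS.
have /choice[b hb] : forall i, exists b, ok (f i) b by move=> i; have [_] := fCC i.
have mf i : measurable (f i : set (borel G)).
  by apply: sub_sigma_algebra; apply: oBB; have [] := fCC i.
exists (seqDU f), b; split.
- exact: seqDU_measurable.
- exact: trivIset_seqDU.
- rewrite -seqDU_bigcup_eq; apply/seteqP; split => // x _.
  have [U CU Ux] := cover x; have [i _ fi] : (f @` setT) U by exact: surj.
  by exists i => //; rewrite fi.
- by move=> i x t Bx; apply: hb; exact: (@subset_seqDU _ f i x Bx).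
Qed.

End FeatureMaps.

(** * Uniform law of large numbers for mean embeddings *)

Section UniformLaw.
Context (R : realType) (E : lmodType R) (H : semi_inner E)
  (Theta : topologicalType) (G : ptopologicalType) (phi : Theta -> G -> E).
Local Notation dom := (si_dom H).
Local Notation ip := (si_ip H).
Local Notation nrm := (si_norm H).
Hypothesis dphi : forall t x, dom (phi t x).
Hypothesis phi_cont :
  continuous (fun z : Theta * (G * G) => ip (phi z.1 z.2.1) (phi z.1 z.2.2) : R^o).
Hypothesis G2 : @second_countable G.
Context (Q : probability (borel G) R).

(** The norm that the mean of [phi t] under [Q] would have, written as a dual
    norm so that no vector-valued integral has to exist. *)
Definition mean_embedding_norm (t : Theta) : \bar R :=
  ereal_sup [set (\int[Q]_x (ip f (phi t x))%:E)%E |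
    f in [set f | dom f /\ ip f f <= 1]].

Definition empirical_mean (n : nat) (x : nat -> G) (t : Theta) : E :=
  n%:R^-1 *: \sum_(i < n) phi t (x i).

Context (K : set Theta) (g : G -> R).
Hypothesis cK : compact K.
Hypothesis mg : measurable_fun [set: borel G] (g : borel G -> R).
Hypothesis phi_le : forall t x, K t -> nrm (phi t x) <= g x.
Hypothesis g0 : forall x, 0 <= g x.
Hypothesis g2 : (\int[Q]_x (g x ^+ 2)%:E < +oo)%E.

Let g_int : Q.-integrable [set: borel G] (EFin \o g).
Proof.
have c1 : Q.-integrable [set: borel G] (EFin \o (fun=> 1 : R)).
  exact: finite_measure_integrable_cst.
have i2 : Q.-integrable [set: borel G] (EFin \o (fun x => g x ^+ 2)).
  apply/integrableP; split.
    by apply/measurable_EFinP; exact: measurable_funX.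
  by under eq_integral do rewrite /= ger0_norm ?sqr_ge0//.
apply: (le_integrable measurableT _ _ (integrableD measurableT i2 c1)).
  exact/measurable_EFinP.
move=> x _ /=; rewrite lee_fin !ger0_norm ?addr_ge0 ?sqr_ge0//.
by have := sqr_ge0 (g x - 1); have := g0 x; nra.
Qed.

Let coord_int (t : Theta) (f : E) : K t -> dom f ->
  Q.-integrable [set: borel G] (EFin \o (fun x => ip f (phi t x))).
Proof.
move=> Kt df.
have := integrableZl measurableT (nrm f) g_int.
apply: le_integrable => //.
  by apply/measurable_EFinP; apply: continuous_borel_measurable; exact: feature_coord_continuous.
move=> x _ /=; rewrite lee_fin normrM !(@ger0_norm _ (nrm f)) ?si_norm_ge0//.
apply: le_trans (si_cauchy_schwarz df (dphi t x)) _.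
by rewrite ler_wpM2l ?si_norm_ge0// (le_trans (phi_le x Kt))// ler_norm.
Qed.

(** Mass far out in the partition is cut off by dominated convergence. *)
Let small_tail (B : nat -> set (borel G)) (e : R) : 0 < e ->
  (forall i, measurable (B i)) -> \bigcup_i B i = setT ->
  exists M, (\int[Q]_x (g x * \1_(~` \big[setU/set0]_(i < M) B i) x)%:E <= e%:E)%E.
Proof.
move=> e0 mB UB.
pose F M (x : borel G) : \bar R := (g x * \1_(~` \big[setU/set0]_(i < M) B i) x)%:E.
have mF M : measurable_fun setT (F M).
  apply/measurable_EFinP; apply: measurable_funM => //.
  by apply: measurable_indic; apply: measurableC; exact: bigsetU_measurable.
have Flim : {ae Q, forall x, setT x -> F ^~ x @ \oo --> (0 : \bar R)}.
  apply: aeW => x _; apply: cvg_near_cst.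
  have [i _ Bix] : (\bigcup_i B i) x by rewrite UB.
  exists i.+1 => // M /= iM; rewrite /F indicE memNset ?mulr0//=; apply.
  by rewrite -bigcup_mkord; exists i.
have Fle : {ae Q, forall x n, setT x -> (`|F n x| <= (EFin \o g) x)%E}.
  apply: aeW => x n _; rewrite /F /= lee_fin ger0_norm ?mulr_ge0//.
  by rewrite indicE; case: (_ \in _); rewrite ?mulr1// mulr0.
have [_ _] := dominated_convergence measurableT mF (measurable_cst _) Flim g_int Fle.
rewrite integral0 => /fine_cvgP[] fF /cvgrPdist_lt/(_ e e0) FF.
have [M _ hM] := filterI fF FF.
have [fM] := hM M (leqnn M).
rewrite /= sub0r normrN => lte; exists M; rewrite -/(F M).
have {}lte := le_lt_trans (ler_norm _) lte.
by rewrite -[leLHS]fineK// lee_fin ltW.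
Qed.

Context (d : measure_display) (Omega : measurableType d) (P : probability Omega R)
  (X : nat -> {RV P >-> borel G}).
Hypothesis Xind : mutually_independent X.
Hypothesis Xlaw : forall i A, measurable A -> distribution P (X i) A = Q A.

(** The feature map is replaced by a step function: on the first cells of the
    partition it takes the value at a chosen point, elsewhere it is cut off.  The
    error is at most a fraction of [e] plus the envelope on the tail, uniformly in the
    parameter, both for the population mean and for the empirical one; and the
    means of the step function converge because finitely many frequencies do. *)
Let uniform_law_eps (e : R) : 0 < e ->
  (forall t, K t -> mean_embedding_norm t \is a fin_num) /\
  {ae P, forall omega, \forall n \near \oo, forall t, K t ->
    `|nrm (empirical_mean n (fun i => X i omega) t) - fine (mean_embedding_norm t)| <= e}.
Proof.
(* Of the budget [6 dl], the population mean uses [2 dl] and the empirical mean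
   [4 dl]. *)
move=> e0; pose dl := e / 6; have dl0 : 0 < dl by rewrite divr_gt0.
have [B [b [mB tB UB hB]]] := feature_partition dphi phi_cont G2 cK dl0.
have [M hM] := small_tail dl0 mB UB.
set tail := ~` _ in hM.
have mtail : measurable tail by apply: measurableC; exact: bigsetU_measurable.
pose gT (x : borel G) : R := g x * \1_tail x.
have gT0 x : 0 <= gT x by rewrite mulr_ge0.
have mgT : measurable_fun setT gT.
  by apply: measurable_funM => //; exact: measurable_indic.
pose ste t x := \sum_(j < M) (\1_(B j) x : R) *: phi t (b j).
have dste t x : dom (ste t x) by apply: si_dom_sum => j _; exact: si_domZ.
have ste_near t x : K t -> nrm (phi t x - ste t x) <= dl + gT x.
  move=> Kt; have [xT|] := pselect (tail x).
    rewrite /ste big1 ?subr0 /gT ?indicE ?mem_set//=.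
      by rewrite mulr1 ler_wpDl ?(ltW dl0)// phi_le.
    move=> j _; rewrite indicE memNset ?scale0r// => Bjx; apply: xT.
    by rewrite -bigcup_mkord; exists j => //=.
  move=> /contrapT; rewrite -bigcup_mkord => -[j /= jM Bjx].
  rewrite /ste (bigD1 (Ordinal jM))//= big1 => [|i ij].
    rewrite indicE mem_set//= scale1r addr0 ler_wpDr//.
    exact: hB.
  rewrite indicE memNset ?scale0r// => Bix.
  by move/negP : ij; apply; apply/eqP/val_inj; apply: tB => //; exists x.
pose q j := fine (Q (B j)).
have qE j : Q (B j) = (q j)%:E by rewrite fineK// fin_num_measure.
have EI j : (\int[Q]_x (\1_(B j) x : R)%:E = (q j)%:E)%E.
  by rewrite integral_indic// setIT -qE.
pose v t := \sum_(j < M) q j *: phi t (b j).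
have dv t : dom (v t) by apply: si_dom_sum => j _; exact: si_domZ.
have c1 : Q.-integrable [set: borel G] (EFin \o (fun=> dl)).
  exact: finite_measure_integrable_cst.
have iT : Q.-integrable [set: borel G] (EFin \o gT).
  apply: (le_integrable measurableT _ _ g_int); first exact/measurable_EFinP.
  move=> x _; rewrite /= lee_fin !ger0_norm// /gT indicE.
  by case: (_ \in _); rewrite ?mulr1// mulr0.
have EU : (\int[Q]_x ((EFin \o (fun=> dl)) x + (EFin \o gT) x) <= (2 * dl)%:E)%E.
  rewrite integralD//.
  have -> : (2 * dl)%:E = (dl%:E + dl%:E)%E by rewrite -EFinD; congr EFin; ring.
  apply: leeD => //.
  have := integral_cst Q measurableT dl%:E.
  rewrite [X in (_ * X)%E](_ : _ = 1%E); last exact: probability_setT.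
  by rewrite mule1 => ->.
have iU : Q.-integrable [set: borel G] (fun x => (EFin \o (fun=> dl)) x + (EFin \o gT) x)%E.
  exact: integrableD.
have population t : K t -> forall f, dom f -> ip f f <= 1 ->
    ((ip f (v t) - 2 * dl)%:E <= \int[Q]_x (ip f (phi t x))%:E)%E /\
    (\int[Q]_x (ip f (phi t x))%:E <= (ip f (v t) + 2 * dl)%:E)%E.
  move=> Kt f df f1.
  have iA := coord_int Kt df.
  have steE x : (ip f (ste t x))%:E =
      (\sum_(j < M) (ip f (phi t (b j)))%:E * (\1_(B j) x)%:E)%E.
    rewrite si_ip_sumr//; last by move=> j; exact: si_domZ.
    by rewrite sumEFin; congr EFin; apply: eq_bigr => j _; rewrite si_ipZr// mulrC.
  have i1 j : Q.-integrable [set: borel G] (fun x => (\1_(B j) x : R)%:E).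
    exact: integrable_indic.
  have iB : Q.-integrable [set: borel G] (fun x => (ip f (ste t x))%:E).
    under eq_fun do rewrite steE.
    by apply: integrable_sum => // j _; exact: integrableZl.
  have EB : (\int[Q]_x (ip f (ste t x))%:E = (ip f (v t))%:E)%E.
    under eq_integral do rewrite steE.
    rewrite integral_sum//; last by move=> j; exact: integrableZl.
    rewrite si_ip_sumr//; last by move=> j; exact: si_domZ.
    rewrite -sumEFin; apply: eq_bigr => j _.
    rewrite integralZl// EI si_ipZr//.
    by rewrite -EFinM mulrC.
  have AB x : `|ip f (phi t x) - ip f (ste t x)| <= dl + gT x.
    rewrite -si_ipBr//; apply: le_trans (si_cauchy_schwarz df _) _.
      exact: si_domB.
    rewrite -[leRHS]mul1r; apply: ler_pM; rewrite ?si_norm_ge0 ?ste_near//.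
    by rewrite -sqrtr1 ler_wsqrtr.
  split.
    rewrite EFinB leeBlDr// -EB.
    apply: le_trans (leeD (lexx _) EU).
    rewrite -integralD//; apply: le_integral => //; first exact: integrableD.
    move=> x _; rewrite lee_fin.
    by have := AB x; rewrite ler_norml => /andP[? ?]; lra.
  rewrite EFinD -EB; apply: le_trans (leeD (lexx _) EU).
  rewrite -integralD//; apply: le_integral => //; first exact: integrableD.
  move=> x _; rewrite lee_fin.
  by have := AB x; rewrite ler_norml => /andP[? ?]; lra.
have finite t : K t -> exists2 c, mean_embedding_norm t = c%:E & `|c - nrm (v t)| <= 2 * dl.
  move=> Kt; apply: (ereal_sup_si_norm (dv t)); exact: population.
split; first by move=> t /finite[c ->].
(* The strong law is applied to the envelope on the tail and to the cells. *)
have [mT mTE slT] : exists2 m : R, (\int[Q]_x (gT x)%:E)%E = m%:E &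
    {ae P, forall x, (fun n => (\sum_(i < n) gT (X i x)) / n%:R) @ \oo --> m}.
  apply: strong_law => //; apply: le_lt_trans g2; apply: ge0_le_integral => //.
  - by move=> x _; rewrite lee_fin sqr_ge0.
  - by apply/measurable_EFinP; exact: measurable_funX.
  - by apply/measurable_EFinP; exact: measurable_funX.
  - move=> x _; rewrite lee_fin /gT indicE.
    by case: (_ \in _); rewrite ?mulr1// mulr0 expr0n/= sqr_ge0.
have slB : {ae P, forall x, forall j,
    (fun n => (\sum_(i < n) (\1_(B j) (X i x) : R)) / n%:R) @ \oo --> q j}.
  apply: ae_foralln => j.
  have [//|//||m mE] := @strong_law _ _ _ _ _ P X Q Xind Xlaw (\1_(B j)).
  - rewrite (_ : (fun x => _) = fun x => (\1_(B j) x : R)%:E) ?EI ?ltry//.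
    by apply/funext => x; rewrite indicE; case: (_ \in _); rewrite ?expr1n ?expr0n.
  - move: mE; rewrite EI => -[<-].
    exact.
move: slT slB; apply: filterS2 => omega slT slB.
have mTle : mT < 2 * dl.
  by move: hM; rewrite mTE lee_fin => /le_lt_trans; apply; lra.
pose p n j := (\sum_(i < n) (\1_(B j) (X i omega) : R)) / n%:R.
have sum_cvg : (fun n => \sum_(j < M) `|p n j - q j| * g (b j)) @ \oo --> (0 : R).
  rewrite [X in _ --> X](_ : 0 = \sum_(j < M) `|q j - q j| * g (b j)); last first.
    by rewrite big1// => j _; rewrite subrr normr0 mul0r.
  apply: cvg_big => [|j _]; first exact: (@add_continuous R^o).
  apply: cvgM; last exact: cvg_cst.
  by apply: cvg_norm; apply: cvgB; [exact: slB|exact: cvg_cst].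
have ev1 : \forall n \near \oo, (\sum_(i < n) gT (X i omega)) / n%:R < 2 * dl.
  exact: (cvgr_lt mT).
have ev2 : \forall n \near \oo, \sum_(j < M) `|p n j - q j| * g (b j) < dl.
  exact: (cvgr_lt 0).
have ev3 : \forall n \near \oo, (0 < n)%N by exists 1%N.
near=> n.
have n0 : (n%:R : R) != 0 by rewrite pnatr_eq0 -lt0n; near: n; exact: ev3.
have hT : (\sum_(i < n) gT (X i omega)) / n%:R < 2 * dl by near: n; exact: ev1.
have hp : \sum_(j < M) `|p n j - q j| * g (b j) < dl by near: n; exact: ev2.
have ninv : 0 <= (n%:R^-1 : R) by rewrite invr_ge0.
move=> t Kt.
have [c -> cv] := finite t Kt.
pose em := empirical_mean n (fun i => X i omega) t.
pose w := \sum_(j < M) p n j *: phi t (b j).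
have dem : dom em by apply: si_domZ; exact: si_dom_sum.
have dw : dom w by apply: si_dom_sum => j _; exact: si_domZ.
have wE : w = n%:R^-1 *: \sum_(i < n) ste t (X i omega).
  rewrite exchange_big/= scaler_sumr; apply: eq_bigr => j _.
  by rewrite -scaler_suml scalerA /p mulrC.
have h1 : nrm (em - w) <= 3 * dl.
  rewrite wE -scalerBr -sumrB si_normZ; last first.
    by apply: si_dom_sum => i _; exact: si_domB.
  rewrite ger0_norm//.
  have dB (i : 'I_n) : dom (phi t (X i omega) - ste t (X i omega)) by exact: si_domB.
  apply: le_trans (ler_wpM2l ninv (ler_si_norm_sum _ dB)) _.
  apply: (@le_trans _ _ (n%:R^-1 * \sum_(i < n) (dl + gT (X i omega)))).
    by rewrite ler_wpM2l// ler_sum// => i _; exact: ste_near.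
  rewrite big_split/= sumr_const card_ord mulrDr -(mulr_natl dl) mulKf//.
  by rewrite (mulrC _ (\sum_(i < n) _)); move: hT; lra.
have h2 : nrm (w - v t) <= dl.
  rewrite /w /v -sumrB.
  apply: (@le_trans _ _ (\sum_(j < M) `|p n j - q j| * g (b j))); last first.
    exact: ltW.
  under eq_bigr do rewrite -scalerBl.
  apply: le_trans (ler_si_norm_sum _ _) _; first by move=> j; exact: si_domZ.
  by apply: ler_sum => j _; rewrite si_normZ// ler_wpM2l// phi_le.
have h3 : nrm (em - v t) <= 4 * dl.
  rewrite -(subrK w em) -addrA.
  apply: le_trans (ler_si_normD (si_domB dem dw) (si_domB dw (dv t))) _.
  by apply: le_trans (lerD h1 h2) _; lra.
have := ler_dist_si_norm dem (dv t); rewrite -/em /= => h4.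
have eE : e = 6 * dl by rewrite /dl; field.
rewrite eE -(subrKA (nrm (v t))); apply: le_trans (ler_normD _ _) _.
rewrite (distrC (nrm (v t))); move: h3 h4 cv; lra.
Unshelve. all: by end_near. Qed.

(** One exceptional set serves all tolerances, since the tolerances [1 / (k + 1)]
    suffice. *)
Lemma uniform_law :
  (forall t, K t -> mean_embedding_norm t \is a fin_num) /\
  {ae P, forall omega, forall e : R, 0 < e -> \forall n \near \oo, forall t, K t ->
    `|nrm (empirical_mean n (fun i => X i omega) t) - fine (mean_embedding_norm t)| <= e}.
Proof.
split; first by have [] := uniform_law_eps (@ltr01 R).
have h k : {ae P, forall omega, \forall n \near \oo, forall t, K t ->
    `|nrm (empirical_mean n (fun i => X i omega) t) - fine (mean_embedding_norm t)|
      <= k.+1%:R^-1}.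
  have k0 : 0 < k.+1%:R^-1 :> R by rewrite invr_gt0.
  by have [] := uniform_law_eps k0.
move/ae_foralln : h; apply: filterS => omega h e e0.
have [k _ hk] : \forall k \near \oo, k.+1%:R^-1 < e :> R.
  by have /cvgrPdist_lt/(_ e e0) := @cvg_harmonic R; apply: filterS => k;
     rewrite /= sub0r normrN ger0_norm.
move: (h k); apply: filterS => n hn t Kt; apply: le_trans (hn t Kt) _.
by rewrite ltW// hk/=.
Qed.

End UniformLaw.

(** * Mixed second difference quotients *)

Section MixedQuotient.
Context (R : realType).

Lemma mvt_at0 (g dg : R -> R) (r t : R) :
  (forall x : R, `|x| < r -> is_derive x 1 g (dg x)) -> `|t| < r ->
  exists2 c, `|c| <= `|t| & g t - g 0 = dg c * t.
Proof.
move=> hg tr.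
have cont (i : interval R) : (forall x, x \in i -> `|x| < r) ->
    {within [set` i], continuous g}.
  by move=> ir; apply: derivable_within_continuous => x /ir/hg hx; exact: ex_derive.
have [t0|t0] := leP 0 t.
  have lt x : x \in `[0, t] -> `|x| <= `|t|.
    by rewrite in_itv/= => /andP[x0 xt]; rewrite !ger0_norm.
  have [||c ct ->] := @MVT_segment R g dg 0 t t0.
  - move=> x /subset_itv_oo_cc/lt xt; apply: hg; exact: le_lt_trans tr.
  - by apply: cont => x /lt xt; exact: le_lt_trans tr.
  - by exists c; [exact: lt|rewrite subr0].
have lt x : x \in `[t, 0] -> `|x| <= `|t|.
  by rewrite in_itv/= => /andP[x0 xt]; rewrite (ltr0_norm t0) ler0_norm// lerN2.
have [||c ct h] := @MVT_segment R g dg t 0 (ltW t0).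
- move=> x /subset_itv_oo_cc/lt xt; apply: hg; exact: le_lt_trans tr.
- by apply: cont => x /lt xt; exact: le_lt_trans tr.
- by exists c; [exact: lt|rewrite -opprB h sub0r mulrN opprK].
Qed.

(** Both derivatives are limits of literally the same difference quotients. *)
Lemma is_derive_line (V : normedModType R) (f : V -> R^o) (z w : V) (t : R) :
  differentiable f (z + t *: w) ->
  is_derive t (1 : R) (fun s : R => f (z + s *: w) : R^o) ('D_w f (z + t *: w)).
Proof.
move=> df.
have E : (fun h : R => h^-1 *: (((fun s : R => f (z + s *: w) : R^o) \o shift t) (h *: (1 : R^o)) -
    f (z + t *: w))) =
   (fun h : R => h^-1 *: ((f \o shift (z + t *: w)) (h *: w) - f (z + t *: w))).
  apply/funext => h /=; congr (_ *: (f _ - _)).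
  by rewrite [h *: _]mulr1 scalerDl addrCA.
split; last by rewrite /derive E.
by rewrite /derivable E; exact: diff_derivable.
Qed.

(** Two applications of the mean value theorem, one in each argument, turn the
    quotient into a mixed second derivative at an intermediate point, which is
    continuous. *)
Lemma mixed_quotient (V : normedModType R) (U : set (V * V)) (f : V * V -> R^o)
    (a v : V) : open U -> U (a, a) -> Cn 2 U f ->
  exists L : R, forall e : R, 0 < e -> exists2 r, 0 < r & forall s t : R,
    s != 0 -> t != 0 -> `|s| < r -> `|t| < r ->
    `|(f (a + s *: v, a + t *: v) - f (a + s *: v, a)
       - f (a, a + t *: v) + f (a, a)) / (s * t) - L| < e.
Proof.
move=> oU Ua [df /(_ (0, v))[d2f /(_ (v, 0)) cf]].
pose f2 := fun x => 'D_(0, v) f x.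
pose f12 := fun x => 'D_(v, 0) f2 x.
exists (f12 (a, a)) => e e0.
pose p (z : R * R) : V * V := (a + z.1 *: v, a + z.2 *: v).
have cp : continuous p.
  move=> z.
  have c1 : (fun z : R * R => a + z.1 *: v) @ z --> a + z.1 *: v.
    by apply: cvgD; [exact: cvg_cst|apply: cvgZr_tmp; exact: cvg_fst].
  have c2 : (fun z : R * R => a + z.2 *: v) @ z --> a + z.2 *: v.
    by apply: cvgD; [exact: cvg_cst|apply: cvgZr_tmp; exact: cvg_snd].
  exact: (cvg_pair c1 c2).
have p0 : p (0, 0) = (a, a) by rewrite /p/= !scale0r !addr0.
have nU : \forall z \near (0 : R, 0 : R), U (p z).
  have hU : nbhs (p (0, 0)) U by rewrite p0; exact: open_nbhs_nbhs.
  exact: (@cp (0, 0) U hU).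
have nL : \forall z \near (0 : R, 0 : R), `|f12 (a, a) - f12 (p z)| < e.
  have hf : f12 @ p (0, 0) --> f12 (a, a) by rewrite p0; exact: cf.
  have /cvgrPdist_lt := cvg_comp _ _ (@cp (0, 0)) hf; exact.
have [r /= r0 hr] : exists2 r : R, 0 < r & forall s t : R, `|s| < r -> `|t| < r ->
    U (p (s, t)) /\ `|f12 (a, a) - f12 (p (s, t))| < e.
  have : nbhs ((0 : R), (0 : R)) [set z | U (p z) /\ `|f12 (a, a) - f12 (p z)| < e].
    exact: filterI.
  move=> /nbhs_ballP[r /= r0 hr].
  exists r => // s t sr tr.
  by apply: (hr (s, t)); split; rewrite /ball/= sub0r normrN.
exists r => // s t s0 t0 sr tr.
have r00 : `|0 : R| < r by rewrite normr0.
(* The second difference is the increment of [phi] from [0] to [t], and the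
   derivative of [phi] is in turn an increment, from [0] to [s]. *)
pose phi (t : R) : R := f (p (s, t)) - f (p (0, t)).
have dphi (x : R) : `|x| < r -> is_derive x 1 phi (f2 (p (s, x)) - f2 (p (0, x))).
  move=> xr.
  have aux s' : `|s'| < r -> is_derive x 1 (fun t : R => f (p (s', t)) : R) (f2 (p (s', x))).
    move=> s'r.
    have pE y : p (s', y) = (a + s' *: v, a) + y *: (0, v).
      by rewrite /p /=; congr pair; rewrite /= ?scaler0 ?addr0.
    under eq_fun do rewrite pE.
    rewrite pE; apply: is_derive_line; apply: df; rewrite -pE.
    by have [] := hr s' x s'r xr.
  exact: is_deriveB (aux s sr) (aux 0 r00).
have [tau taut] := mvt_at0 dphi tr.
have taur : `|tau| < r by exact: le_lt_trans tr.
have dpsi (x : R) : `|x| < r -> is_derive x 1 (fun s : R => f2 (p (s, tau)) : R) (f12 (p (x, tau))).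
  move=> xr.
  have pE y : p (y, tau) = (a, a + tau *: v) + y *: (v, 0).
    by rewrite /p /=; congr pair; rewrite /= ?scaler0 ?addr0.
  under eq_fun do rewrite pE.
  rewrite pE; apply: is_derive_line; apply: d2f; rewrite -pE.
  by have [] := hr x tau xr taur.
have [sg sgs ->] := mvt_at0 dpsi sr.
have sgr : `|sg| < r by exact: le_lt_trans sr.
rewrite /phi /p/= !scale0r !addr0 => E.
rewrite (_ : _ / _ = f12 (p (sg, tau))); first by rewrite distrC; have [] := hr sg tau sgr taur.
apply: (mulIf (mulf_neq0 s0 t0)); rewrite divfK ?mulf_neq0// mulrA -E; ring.
Qed.

End MixedQuotient.

(** * Differentiation in a reproducing kernel Hilbert space *)

Section KernelDerivative.
Context (R : realType) (m : nat) (G : lieGroupType R m) (k : G -> G -> R) (H : rkhs k).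
Hypothesis k2 : C2_kernel k.

Definition rkhs_semi_inner : semi_inner (G -> R^o) :=
  @SemiInner R (G -> R^o) (rkhs_carrier H) (rkhs_ip H) (rkhs_zero H)
    (@rkhs_linear _ _ _ H) (@rkhs_ip_linear _ _ _ H) (@rkhs_ip_sym _ _ _ H)
    (@rkhs_ip_ge0 _ _ _ H).

Local Notation dom := (si_dom rkhs_semi_inner).
Local Notation ip := (si_ip rkhs_semi_inner).
Local Notation nrm := (si_norm rkhs_semi_inner).

(** The difference quotients of [x |-> k x] along a line of a chart are Cauchy:
    their inner products are mixed second difference quotients of [k].  Their
    limit represents differentiation at [x], because evaluation at a point is
    the inner product with the kernel there. *)
Lemma kernel_derivative (x : G) (v : 'rV[R]_m) :
  exists2 g : G -> R^o, dom g & forall h, dom h ->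
    'D_v (fun u : 'rV[R]_m => h (param x u) : R^o) (chart x x) = ip h g.
Proof.
pose a := chart x x; pose c (t : R) := param x (a + t *: v).
pose U := chart x @` chart_dom x.
have Ua : U a by exists x => //; exact: chart_dom_self.
have oU : open (U `*` U).
  rewrite openE => -[y z] [Uy Uz]; exists (U, U) => //; split;
    by apply: open_nbhs_nbhs; split => //; exact: chart_img_open.
have [L hL] := mixed_quotient v oU (conj Ua Ua) (@k2 x x).
pose e t : G -> R^o := t^-1 *: ((k (c t) : G -> R^o) - k (c 0)).
have dk y : dom (k y : G -> R^o) by exact: rkhs_kernel.
have de t : dom (e t) by apply: si_domZ; exact: si_domB.
have ipk (h : G -> R^o) y : dom h -> ip h (k y : G -> R^o) = h y.
  by move=> dh; rewrite /= -rkhs_reproducing.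
have ipe h t : dom h -> ip h (e t) = t^-1 * (h (c t) - h (c 0)).
  by move=> dh; rewrite si_ipZr ?si_ipBr ?ipk//; exact: si_domB.
have c0 : c 0 = x by rewrite /c scale0r addr0 chartK//; exact: chart_dom_self.
(* The inner product of two quotients is a mixed second difference quotient. *)
have near_L (eps : R) : 0 < eps -> exists2 r : R, 0 < r & forall s t : R, s != 0 -> t != 0 ->
    `|s| < r -> `|t| < r -> `|ip (e s) (e t) - L| < eps.
  move=> eps0; have [r r0 hr] := hL eps eps0; exists r => // s t s0 t0 sr tr.
  have := hr s t s0 t0 sr tr; congr (`|_ - _| < _).
  rewrite ipe// /e /= /c scale0r addr0 -/a.
  rewrite [RHS](_ : _ = t^-1 *
    (s^-1 * (k (param x (a + s *: v)) (param x (a + t *: v)) -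
             k (param x a) (param x (a + t *: v))) -
     s^-1 * (k (param x (a + s *: v)) (param x a) - k (param x a) (param x a))))//.
  by field; rewrite s0 t0.
have near_e (eps : R) : 0 < eps -> exists2 r : R, 0 < r & forall s t : R, s != 0 -> t != 0 ->
    `|s| < r -> `|t| < r -> ip (e s - e t) (e s - e t) < eps.
  move=> eps0; have e40 : 0 < eps / 4 by rewrite divr_gt0.
  have [r r0 hr] := near_L _ e40; exists r => // s t s0 t0 sr tr.
  rewrite si_sqr_normB//.
  have := hr s s s0 s0 sr sr; have := hr s t s0 t0 sr tr; have := hr t t t0 t0 tr tr.
  rewrite !ltr_norml => /andP[? ?] /andP[? ?] /andP[? ?]; lra.
(* Completeness is available for sequences, so the limit is taken along [1 / (n + 1)]. *)
pose u n := e (n.+1%:R^-1).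
have un0 n : (n.+1%:R^-1 : R) != 0 by rewrite invr_eq0 pnatr_eq0.
have small (r : R) : 0 < r -> exists N, forall n, (N <= n)%N -> `|n.+1%:R^-1 : R| < r.
  move=> r0; have /cvgrPdist_lt/(_ r r0)[N _ hN] := @cvg_harmonic R.
  by exists N => n Nn; have := hN n Nn; rewrite /= sub0r normrN.
have [|g dg ug] := @rkhs_complete _ _ _ H u (fun n => de _).
  move=> eps eps0; have [r r0 hr] := near_e eps eps0.
  have [N hN] := small r r0; exists N => i j Ni Nj.
  by apply: hr => //; exact: hN.
have eg (eps : R) : 0 < eps -> exists2 r, 0 < r &
    forall t, t != 0 -> `|t| < r -> nrm (e t - g) < eps.
  move=> eps0; have d0 : 0 < eps / 2 by rewrite divr_gt0.
  have [r r0 hr] := near_e _ (exprn_gt0 2 d0); exists r => // t t0 tr.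
  have [N1 hN1] := small r r0.
  move/cvgrPdist_lt : ug => /(_ _ (exprn_gt0 2 d0))[N2 _ hN2].
  pose n := (N1 + N2)%N.
  have dsq f : dom f -> ip f f < (eps / 2) ^+ 2 -> nrm f < eps / 2.
    move=> df hf; rewrite -ltr_sqr ?nnegrE ?si_norm_ge0 ?(ltW d0)//.
    by rewrite sqr_si_norm.
  have h1 : nrm (e t - u n) < eps / 2.
    by apply: dsq; [exact: (si_domB (de t) (de _))|apply: hr => //; apply: hN1; exact: leq_addr].
  have h2 : nrm (u n - g) < eps / 2.
    apply: dsq; first exact: (si_domB (de _) dg).
    have := hN2 n (leq_addl _ _); rewrite sub0r normrN; apply: le_lt_trans.
    exact: ler_norm.
  rewrite -(subrK (u n) (e t)) -addrA.
  apply: le_lt_trans (ler_si_normD (si_domB (de t) (de _)) (si_domB (de _) dg)) _.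
  by rewrite (splitr eps) ltrD.
exists g => // h dh.
have ipeg : (fun t => ip h (e t)) @ (0 : R)^' --> ip h g.
  apply/cvgrPdist_lt => eps eps0.
  pose M := nrm h + 1; have M0 : 0 < M by rewrite ltr_wpDl// si_norm_ge0.
  have [r r0 hr] := eg _ (divr_gt0 eps0 M0).
  exists r => // t /=; rewrite sub0r normrN => tr t0.
  have cs : `|ip h (e t) - ip h g| <= nrm h * nrm (e t - g).
    by rewrite -si_ipBr//; exact: (si_cauchy_schwarz dh (si_domB (de t) dg)).
  rewrite distrC; apply: le_lt_trans cs _.
  apply: (@le_lt_trans _ _ (M * nrm (e t - g))).
    by rewrite ler_wpM2r ?si_norm_ge0// lerDl.
  by rewrite mulrC -ltr_pdivlMr// hr.
apply/cvg_lim => //.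
rewrite (_ : (fun h0 : R => _) = fun t => ip h (e t)) //.
apply/funext => t; rewrite ipe//= c0 /c; congr (_ * (h (param x _) - h _)).
  by rewrite addrC.
by rewrite chartK//; exact: chart_dom_self.
Qed.

End KernelDerivative.

(** * Integration against a density *)

Section Density.
Context (R : realType) (d : measure_display) (T : measurableType d)
  (mu nu : {measure set T -> \bar R}) (w : T -> R).
Hypothesis mw : measurable_fun setT w.
Hypothesis w0 : forall x, 0 <= w x.
Hypothesis nuE : forall A, measurable A -> (nu A = \int[mu]_(x in A) (w x)%:E)%E.
Import HBNNSimple.

(** Monotone convergence reduces the claim to simple functions, for which it is
    the definition of [nu]. *)
Lemma ge0_integral_density (f : T -> \bar R) :
  measurable_fun setT f -> (forall x, (0 <= f x)%E) ->
  (\int[nu]_x f x = \int[mu]_x (f x * (w x)%:E))%E.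
Proof.
move=> mf f0; pose f_ := nnsfun_approx measurableT mf.
have mwE : measurable_fun setT (EFin \o w) by exact/measurable_EFinP.
have f_cvg x : (fun n => (f_ n x)%:E) @ \oo --> f x.
  by apply: cvg_nnsfun_approx => // y _; exact: f0.
transitivity (limn (fun n => \int[nu]_x (f_ n x)%:E)%E).
  rewrite -monotone_convergence//.
  - by apply: eq_integral => y _; apply/esym/cvg_lim.
  - by move=> n; exact/measurable_EFinP/measurable_funP.
  - by move=> n y _; rewrite lee_fin.
  - by move=> y _ m n mn; rewrite lee_fin; exact/lefP/nd_nnsfun_approx.
rewrite [X in limn X](_ : _ = (fun n => \int[mu]_x ((f_ n x)%:E * (w x)%:E))%E).
  rewrite -monotone_convergence//.
  - apply: eq_integral => y _; apply/cvg_lim => //.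
    by apply: cvgeZr => //; exact: f_cvg.
  - by move=> n; apply: emeasurable_funM => //; exact/measurable_EFinP/measurable_funP.
  - by move=> n y _; rewrite -EFinM lee_fin mulr_ge0.
  - move=> y _ m n mn; rewrite -!EFinM lee_fin ler_wpM2r//.
    exact/lefP/nd_nnsfun_approx.
apply/funext => n.
have mpre r : measurable (f_ n @^-1` [set r]) by [].
transitivity (\sum_(r \in range (f_ n)) (r%:E * nu (f_ n @^-1` [set r])))%E.
  under eq_integral do rewrite fimfunE -fsumEFin//.
  rewrite ge0_integral_fsum//; last 2 first.
  - by move=> y; exact/measurable_EFinP/measurable_funM.
  - by move=> y x _; rewrite nnfun_muleindic_ge0.
  apply: eq_fsbigr => r _; rewrite integralZl_indic_nnsfun// integral_indic//=.
  by rewrite setIT.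
transitivity (\sum_(r \in range (f_ n))
    \int[mu]_x ((r * \1_(f_ n @^-1` [set r]) x)%:E * (w x)%:E))%E.
  apply: eq_fsbigr => r rf.
  have r0 : 0 <= r by move: rf; rewrite inE => -[x _ <-].
  rewrite nuE// integral_mkcond -ge0_integralZl//; last 2 first.
  - exact/(measurable_restrictT _ (mpre r)).1/measurable_funTS.
  - by move=> x _; rewrite erestrict_ge0// => y _; rewrite lee_fin.
  apply: eq_integral => x _; rewrite patchE indicE.
  by case: (_ \in _); rewrite ?mulr1 ?mulr0 ?mul0e ?mule0.
rewrite -ge0_integral_fsum//.
- apply: eq_integral => x _; rewrite -ge0_mule_fsuml//.
    by rewrite fsumEFin// -fimfunE.
  by move=> r; rewrite nnfun_muleindic_ge0.
- move=> r; apply: emeasurable_funM => //.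
  by apply/measurable_EFinP; apply: measurable_funM.
- by move=> r x _; rewrite mule_ge0 ?nnfun_muleindic_ge0// lee_fin.
Qed.

Lemma integral_density (f : T -> \bar R) : measurable_fun setT f ->
  (\int[nu]_x f x = \int[mu]_x (f x * (w x)%:E))%E.
Proof.
move=> mf; rewrite integralE [RHS]integralE; congr (_ - _)%E.
  rewrite ge0_integral_density//; last exact: measurable_funepos.
  apply: eq_integral => x _; rewrite !funeposE.
  by rewrite maxe_pMl ?mul0e// lee_fin.
rewrite ge0_integral_density//; last exact: measurable_funeneg.
by apply: eq_integral => x _; rewrite !funenegE maxe_pMl ?mul0e ?mulNe// lee_fin.
Qed.
End Density.

(** * Stein features *)

Section SteinFeatures.
Context (R : realType) (m : nat) (G : lieGroupType R m).
Context (D : 'I_m -> vector_field G) (Delta : G -> R).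
Context (k : G -> G -> R) (H : rkhs k).
Hypothesis ksym : forall x y, k x y = k y x.
Hypothesis k2 : C2_kernel k.

(** Apart from the derivative, which [kernel_derivative] represents by a vector,
    the operator multiplies by numbers, and evaluation is represented by the
    kernel. *)
Lemma stein1_section (l : 'I_m) (p : G -> R) (x : G) :
  rkhs_carrier H (stein_section D Delta k l p x) /\
  forall h, rkhs_carrier H h ->
    stein1 D Delta l p h x = rkhs_ip H h (stein_section D Delta k l p x).
Proof.
have [g dg hg] := kernel_derivative H k2 x (D l x).
pose c := Dlog D l p x + Dlog D l Delta x.
have dk y : rkhs_carrier H (k y) by exact: rkhs_kernel.
have E : stein_section D Delta k l p x = (fun z => c * k x z + g z).
  apply/funext => z; rewrite /stein_section.
  rewrite (_ : k^~ z = k z); last by apply/funext => y; rewrite ksym.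
  rewrite /stein1 /vf_apply (hg (k z) (dk z)) (ksym z x).
  rewrite (_ : si_ip _ _ _ = g z); first by rewrite /c; ring.
  by rewrite /= rkhs_ip_sym// -rkhs_reproducing.
split; first by rewrite E; exact: rkhs_linear.
move=> h dh; rewrite E rkhs_ip_sym//; last exact: rkhs_linear.
rewrite rkhs_ip_linear// !(rkhs_ip_sym _ dh)// -rkhs_reproducing//.
rewrite /stein1 /vf_apply (hg h dh) /= /c; ring.
Qed.

Definition rkhs_power_dom (f : 'I_m -> G -> R^o) : Prop := forall l, rkhs_carrier H (f l).
Definition rkhs_power_ip (f g : 'I_m -> G -> R^o) : R := \sum_l rkhs_ip H (f l) (g l).

Program Definition rkhs_power : semi_inner ('I_m -> G -> R^o) :=
  @SemiInner R _ rkhs_power_dom rkhs_power_ip _ _ _ _ _.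
Next Obligation. by move=> l; exact: rkhs_zero. Qed.
Next Obligation. by move=> a f g df dg l; exact: rkhs_linear. Qed.
Next Obligation.
move=> a f g h df dg dh; rewrite /rkhs_power_ip mulr_sumr -big_split/=.
by apply: eq_bigr => l _; exact: rkhs_ip_linear.
Qed.
Next Obligation. by move=> f g df dg; apply: eq_bigr => l _; exact: rkhs_ip_sym. Qed.
Next Obligation. by move=> f df; apply: sumr_ge0 => l _; exact: rkhs_ip_ge0. Qed.

Definition stein_feature (p : G -> R) (x : G) : 'I_m -> G -> R^o :=
  fun l => stein_section D Delta k l p x.

Lemma stein_feature_dom p x : si_dom rkhs_power (stein_feature p x).
Proof. by move=> l; have [] := stein1_section l p x. Qed.

Lemma stein_featureE p f x : si_dom rkhs_power f ->
  stein D Delta p f x = si_ip rkhs_power f (stein_feature p x).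
Proof.
move=> df; apply: eq_bigr => l _.
by have [_] := stein1_section l p x; exact.
Qed.

(** Scaled by [q / w] so that the average under the sampling density [w] is the
    average of the Stein features under [q]. *)
Definition weighted_feature (q w p : G -> R) (x : G) : 'I_m -> G -> R^o :=
  (q x / w x) *: stein_feature p x.

Lemma weighted_feature_dom q w p x : si_dom rkhs_power (weighted_feature q w p x).
Proof. by apply: si_domZ; exact: stein_feature_dom. Qed.

Lemma weighted_kernelE q w p x y :
  weighted_kernel D Delta H q w p x y =
  si_ip rkhs_power (weighted_feature q w p x) (weighted_feature q w p y).
Proof.
have dx := stein_feature_dom p x; have dy := stein_feature_dom p y.
rewrite si_ipZl ?si_ipZr//; last exact: si_domZ.
rewrite /weighted_kernel -[stein_kernel _ _ _ _ _ _]/(si_ip rkhs_power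
  (stein_feature p x) (stein_feature p y)).
ring.
Qed.

End SteinFeatures.

(** * Convex functions near a compact set of minimizers *)

(** Compactness as an induction principle, which replaces the choice of a finite
    subcover: if [P K] failed, the sets whose complement in [K] has the property
    would form a proper filter without cluster point in [K]. *)
Lemma compact_ind (T : topologicalType) (P : set T -> Prop) (K : set T) :
  P set0 -> (forall A B, A `<=` B -> P B -> P A) ->
  (forall A B, P A -> P B -> P (A `|` B)) -> compact K ->
  (forall x, K x -> exists2 U, nbhs x U & P U) -> P K.
Proof.
move=> P0 PS PU cK hK; apply: contrapT => nPK.
pose F : set_system T := [set A | P (K `&` ~` A)].
have FF : ProperFilter F.
  apply: Build_ProperFilter_ex.
    move=> A FA; apply: contrapT => nA; apply: nPK; apply: PS FA => x Kx; split => //.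
    by move=> Ax; apply: nA; exists x.
  split.
  - by rewrite /F/= setCT setI0.
  - by move=> A B FA FB; rewrite /F/= setCI setIUr; exact: PU.
  - by move=> A B AB; apply: PS => x [Kx nB]; split => // /AB.
have FK : F K by rewrite /F/= setICr.
have [x [Kx clx]] := cK F FF FK.
have [U xU PU'] := hK x Kx.
have FU : F (~` U) by rewrite /F/= setCK; apply: PS PU' => y [].
by have [y [nUy Uy]] := clx _ _ FU xU.
Qed.

Section ConvexBoundary.
Context (R : realType) (N : nat).
Local Notation V := 'rV[R]_N.

Lemma compact_thickening (M U : set V) : compact M -> M `<=` interior U ->
  exists C, [/\ compact C, C `<=` U & M `<=` interior C].
Proof.
move=> cM MU.
pose thickens A := exists C, [/\ compact C, C `<=` U & A `<=` interior C].
apply: (@compact_ind V thickens M) => //.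
- by exists set0; split => //; exact: compact0.
- by move=> A B AB [C [cC CU BC]]; exists C; split => // x /AB/BC.
- move=> A B [C1 [cC1 C1U AC1]] [C2 [cC2 C2U BC2]]; exists (C1 `|` C2); split.
  + exact: compactU.
  + by move=> x [/C1U|/C2U].
  + move=> x [Ax|Bx].
      by apply: (interiorS (A := C1)); [move=> y; left|exact: AC1].
    by apply: (interiorS (A := C2)); [move=> y; right|exact: BC2].
- move=> x /MU /nbhs_closedballP[r rU].
  pose C := closed_ball x r%:num.
  have xC : nbhs x (interior C).
    by apply: nbhs_interior; apply/nbhs_closedballP; exists r.
  exists (interior C) => //; exists C; split => //.
  apply: bounded_closed_compact; last exact: closed_ball_closed.
  exists (`|x| + r%:num); split => // e xe y.
  rewrite /C closed_ballE// /closed_ball_/= => xy; apply: le_trans (ltW xe).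
  by rewrite -[y](subKr x); apply: le_trans (ler_normB _ _) _; rewrite lerD2l.
Qed.

(** Otherwise the interior of [C] would cut a clopen piece out of the segment. *)
Lemma segment_crosses_boundary (C : set V) (x y : V) : closed C ->
  interior C x -> ~ C y -> exists t : {i01 R},
    (C `\` interior C) (t%:num *: x + (1 - t%:num) *: y).
Proof.
move=> clC Cx Cy; apply: contrapT => no.
pose gam (t : R) : V := t *: x + (1 - t) *: y.
have cgam : continuous gam.
  move=> t; apply: cvgD; first by apply: cvgZr_tmp; exact: cvg_id.
  apply: cvgZr_tmp; apply: cvgB; [exact: cvg_cst|exact: cvg_id].
have E : `[0, 1]%classic `&` gam @^-1` (interior C) = `[0, 1]%classic `&` gam @^-1` C.
  apply/seteqP; split => t [t01 Ct]; split => //.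
    by move: Ct; exact: interior_subset.
  apply: contrapT => nC; apply: no.
  move: t01; rewrite /= in_itv/= => t01.
  by exists (Itv01 (andP t01).1 (andP t01).2).
have := @segment_connected R 0 1 (`[0, 1]%classic `&` gam @^-1` (interior C)).
have g1 : gam 1 = x by rewrite /gam scale1r subrr scale0r addr0.
have h0 : (`[0, 1]%classic `&` gam @^-1` (interior C)) 1.
  split; first by rewrite /= in_itv/= lexx ler01.
  by rewrite /preimage/= g1.
move=> /(_ (ex_intro _ _ h0)).
have hop : exists2 O : set R, open O &
    `[0, 1]%classic `&` gam @^-1` (interior C) = `[0, 1]%classic `&` O.
  exists (gam @^-1` (interior C)) => //.
  by apply: open_comp => [t _|]; [exact: cgam|exact: open_interior].
have hcl : exists2 O : set R, closed O &
    `[0, 1]%classic `&` gam @^-1` (interior C) = `[0, 1]%classic `&` O.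
  exists (gam @^-1` C); last by [].
  by apply: closed_comp => // t _; exact: cgam.
move=> /(_ hop hcl) E1.
have : `[0, 1]%classic (0 : R) by rewrite /= in_itv/= lexx ler01.
rewrite -E1 => -[_] /interior_subset.
by rewrite /gam/= scale0r subr0 scale1r add0r.
Qed.

(** On a segment a convex function lies below the larger of its end values. *)
Lemma convex_past_boundary (A : set V) (F : V -> R^o) (x y : V) (t : {i01 R}) :
  convex_function A F -> A x -> A y ->
  F x < F (t%:num *: x + (1 - t%:num) *: y) ->
  F (t%:num *: x + (1 - t%:num) *: y) <= F y.
Proof.
move=> cF Ax Ay; have := cF t x y (mem_set Ax) (mem_set Ay).
rewrite /conv/= => h Fx; rewrite leNgt; apply/negP => Fy.
have t0 : 0 <= t%:num by [].
have t1 : 0 <= 1 - t%:num by rewrite subr_ge0.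
have h1 : t%:num * F x + (1 - t%:num) * F y < F (t%:num *: x + (1 - t%:num) *: y).
  set z := F (_ + _) in Fx Fy *.
  have z1 : t%:num * F x <= t%:num * z by rewrite ler_wpM2l// ltW.
  have z2 : (1 - t%:num) * F y <= (1 - t%:num) * z by rewrite ler_wpM2l// ltW.
  have [s0|s0] := ltP (t%:num) (1 / 2).
    have : (1 - t%:num) * F y < (1 - t%:num) * z by rewrite ltr_pM2l//; lra.
    lra.
  have : t%:num * F x < t%:num * z by rewrite ltr_pM2l//; lra.
  lra.
by move: h; rewrite leNgt => /negP; apply.
Qed.

End ConvexBoundary.

Section Localization.
Context (R : realType) (Theta1 : topologicalType) (N : nat).
Local Notation V := 'rV[R]_N.
Context (Theta2 : set V) (f : Theta1 * V -> R).
Hypothesis cTheta1 : compact [set: Theta1].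
Hypothesis f_cont : forall C, compact C -> C `<=` Theta2 ->
  {within [set: Theta1] `*` C, continuous f}.
Hypothesis f_min : forall t1, let M := argmin Theta2 (fun t => f (t1, t)) in
  [/\ M !=set0, compact M & M `<=` interior Theta2].

Let f_near (C : set V) (t1 : Theta1) (z : V) (e : R) : compact C -> C `<=` Theta2 ->
  C z -> 0 < e -> exists W U, [/\ nbhs t1 W, nbhs z U & forall t1' z', W t1' -> U z' ->
    C z' -> `|f (t1', z') - f (t1, z)| < e].
Proof.
move=> cC CT Cz e0; have /subspace_continuousP := f_cont cC CT.
move=> /(_ (t1, z) (conj I Cz)) /cvgrPdist_lt /(_ e e0).
move=> [[W U] /= [hW hU] h]; exists W, U; split => // t1' z' Wt Uz Cz'.
by rewrite distrC; apply: (h (t1', z')).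
Qed.

(** Around one [t1]: thicken the compact set of minimizers to a compact [C].  On
    the boundary of [C] the function exceeds its minimum by a margin that
    persists for nearby parameters and for uniformly close functions, and a
    convex function that has risen at the boundary cannot come back down. *)
Let localize_at (t1 : Theta1) : exists (W : set Theta1) (C : set V) (dl : R),
  [/\ nbhs t1 W, compact C, C `<=` Theta2, 0 < dl & forall t1', W t1' ->
    exists2 x0, C x0 & forall F : V -> R^o, convex_function Theta2 F ->
      (forall z, C z -> `|F z - f (t1', z)| <= dl) ->
      forall y, Theta2 y -> ~ C y -> F x0 < F y].
Proof.
have [[x0 Mx0] cM MT] := f_min t1.
have [C [cC CT MC]] := compact_thickening cM MT.
have Cx0 : C x0 by apply: interior_subset; exact: MC.
have clC : closed C by apply: compact_closed cC; exact: norm_hausdorff.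
pose B := C `\` interior C.
have cB : compact B.
  apply: (subclosed_compact _ cC); last by move=> x [].
  by apply: closedI => //; rewrite closedC; exact: open_interior.
have [dl [W [dl0 hW gap]]] : exists dl W, [/\ 0 < dl, nbhs t1 W & forall t1' z,
    W t1' -> B z -> 2 * dl < f (t1', z) - f (t1', x0)].
  pose margin (A : set V) := exists dl W, [/\ 0 < dl, nbhs t1 W & forall t1' z,
    W t1' -> A z -> B z -> 2 * dl < f (t1', z) - f (t1', x0)].
  suff [dl [W [dl0 hW h]]] : margin B.
    by exists dl, W; split => // t z Wt Bz; exact: h.
  apply: (@compact_ind V margin B) => //.
  - by exists 1, setT; split => //; exact: filterT.
  - move=> A A' AA' [dl [W [dl0 hW h]]]; exists dl, W; split => // t z Wt /AA'.
    exact: h.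
  - move=> A A' [d1 [W1 [d10 hW1 h1]]] [d2 [W2 [d20 hW2 h2]]].
    exists (Num.min d1 d2), (W1 `&` W2); split.
    + by rewrite lt_min d10.
    + exact: filterI.
    + move=> t z [W1t W2t] [Az|Az] Bz.
        by apply: le_lt_trans (h1 t z W1t Az Bz); rewrite ler_pM2l// ge_min lexx.
      by apply: le_lt_trans (h2 t z W2t Az Bz); rewrite ler_pM2l// ge_min lexx orbT.
  - move=> z [Cz nCz].
    pose g := f (t1, z) - f (t1, x0).
    have g0 : 0 < g.
      rewrite subr_gt0 ltNge; apply/negP => fz; apply: nCz; apply: MC.
      split; first exact: CT.
      by move=> t' T2t'; apply: le_trans fz _; exact: Mx0.2.
    (* Two perturbations of at most [g / 8] leave more than [g / 2]. *)
    have g8 : 0 < g / 8 by rewrite divr_gt0.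
    have [W1 [U [hW1 hU h1]]] := f_near t1 cC CT Cz g8.
    have [W2 [U2 [hW2 hU2 h2]]] := f_near t1 cC CT Cx0 g8.
    exists U => //; exists (g / 4), (W1 `&` W2); split.
    + by rewrite divr_gt0.
    + exact: filterI.
    + move=> t' z' [W1t W2t] Uz [Cz' _].
      have gE : g = f (t1, z) - f (t1, x0) by [].
      have := h1 t' z' W1t Uz Cz'; have := h2 t' x0 W2t (nbhs_singleton hU2) Cx0.
      by rewrite !ltr_norml => /andP[? ?] /andP[? ?]; lra.
exists W, C, dl; split => // t1' Wt; exists x0 => // F cF hF y T2y nCy.
have [t Bt] := segment_crosses_boundary clC (MC _ Mx0) nCy.
set z := _ + _ in Bt; have [Cz _] := Bt.
have Fz : F x0 < F z.
  have := hF _ Cz; have := hF _ Cx0; have := gap _ _ Wt Bt.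
  move: (F x0 : R) (F z : R) => Fx0 Fz.
  by rewrite !ler_norml => ? /andP[? ?] /andP[? ?]; lra.
apply: (lt_le_trans Fz).
exact: (convex_past_boundary cF (CT _ Cx0) T2y Fz).
Qed.

(** By compactness of the parameter space finitely many of the local choices
    suffice, and their union and least margin serve everywhere.  Thus whatever
    is convex and close to [f] on one compact set is minimized there. *)
Lemma convex_localization : exists (C : set V) (dl : R),
  [/\ compact C, C `<=` Theta2, 0 < dl & forall t1,
    exists2 x0, C x0 & forall F : V -> R^o, convex_function Theta2 F ->
      (forall z, C z -> `|F z - f (t1, z)| <= dl) ->
      forall y, Theta2 y -> ~ C y -> F x0 < F y].
Proof.
pose localized (A : set Theta1) := exists (C : set V) (dl : R),
  [/\ compact C, C `<=` Theta2, 0 < dl & forall t1, A t1 ->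
    exists2 x0, C x0 & forall F : V -> R^o, convex_function Theta2 F ->
      (forall z, C z -> `|F z - f (t1, z)| <= dl) ->
      forall y, Theta2 y -> ~ C y -> F x0 < F y].
suff [C [dl [cC CT dl0 h]]] : localized setT.
  by exists C, dl; split => // t1; exact: h.
apply: (@compact_ind Theta1 localized setT) => //.
- by exists set0, 1; split => //; exact: compact0.
- by move=> A B AB [C [dl [cC CT dl0 h]]]; exists C, dl; split => // t /AB; exact: h.
- move=> A1 A2 [C1 [d1 [cC1 C1T d10 h1]]] [C2 [d2 [cC2 C2T d20 h2]]].
  exists (C1 `|` C2), (Num.min d1 d2); split.
  + exact: compactU.
  + by move=> x [/C1T|/C2T].
  + by rewrite lt_min d10.
  + move=> t [/h1[x0 Cx0 hx]|/h2[x0 Cx0 hx]]; exists x0; try by [left|right].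
      move=> F cF hF y T2y nC; apply: hx => //.
        move=> z Cz; apply: le_trans (hF z (or_introl Cz)) _; rewrite ge_min lexx//.
      by move=> Cy; apply: nC; left.
    move=> F cF hF y T2y nC; apply: hx => //.
      by move=> z Cz; apply: le_trans (hF z (or_intror Cz)) _; rewrite ge_min lexx orbT.
    by move=> Cy; apply: nC; right.
- move=> t1 _; have [W [C [dl [hW cC CT dl0 h]]]] := localize_at t1.
  by exists W => //; exists C, dl.
Qed.

End Localization.

(** * Convergence of minimizers *)

Lemma argmin_EFin (R : realType) (T : Type) (A : set T) (F : T -> \bar R) (f : T -> R) :
  (forall t, F t = (f t)%:E) -> argmin A F = argmin A f.
Proof.
move=> Ff; have -> : F = EFin \o f by exact/funext.
by apply/seteqP; split => t [At ht]; split => // s As; have := ht s As; rewrite lee_fin.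
Qed.

Section ArgminConvergence.
Context (R : realType) (Theta : metricType R) (K : set Theta).
Hypothesis cK : compact K.
Hypothesis K0 : K !=set0.

Lemma argmin_nonempty (F : Theta -> R) : {within K, continuous F} ->
  (forall t, ~ K t -> exists2 s, K s & F s < F t) ->
  exists2 c, K c & argmin [set: Theta] F c.
Proof.
move=> cF domF; have [c Kc hc] := compact_EVT_min K0 cK cF.
rewrite inE in Kc; exists c => //; split => // t _.
have [Kt|/domF[s Ks st]] := pselect (K t); first by apply: hc; rewrite inE.
by apply: le_trans (ltW st); apply: hc; rewrite inE.
Qed.

Lemma argmin_in (F : Theta -> R) t :
  (forall t, ~ K t -> exists2 s, K s & F s < F t) ->
  argmin [set: Theta] F t -> K t.
Proof.
move=> domF [_ Ft]; apply: contrapT => /domF[s _]; apply/negP; rewrite -leNgt.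
exact: Ft.
Qed.

(** Away from the minimizers the limit function exceeds its minimum by a margin
    on the compact set, which rules out minimizers of uniformly close
    functions. *)
Lemma argmin_close (f : Theta -> R) (F : nat -> Theta -> R) (e : R) :
  {within K, continuous f} -> (exists2 c, K c & argmin [set: Theta] f c) ->
  (forall e : R, 0 < e -> \forall n \near \oo, forall t, K t -> `|F n t - f t| <= e) ->
  0 < e ->
  \forall n \near \oo, forall t, K t -> argmin [set: Theta] (F n) t ->
    exists2 s, argmin [set: Theta] f s & mdist t s < e.
Proof.
move=> cf [c Kc mc] unif e0.
pose A := K `&` ~` (\bigcup_(s in argmin [set: Theta] f) interior (ball s e)).
have cA : compact A.
  apply: compact_closedI => //; apply: open_closedC.
  by apply: bigcup_open => s _; exact: open_interior.
have notA t : K t -> ~ A t -> exists2 s, argmin [set: Theta] f s & mdist t s < e.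
  move=> Kt nAt; apply: contrapT => no; apply: nAt; split => //.
  move=> [s ms /interior_subset st]; apply: no; exists s => //.
  by move: st; rewrite ballEmdist /= metric_sym.
have [A0|A0] := pselect (A !=set0); last first.
  by apply: nearW => n t Kt _; apply: notA => // At; apply: A0; exists t.
have [a] := compact_EVT_min A0 cA (continuous_subspaceW (fun t (At : A t) => At.1) cf).
rewrite inE => -[Ka nna] ha.
have gap : 0 < f a - f c.
  rewrite subr_gt0 ltNge; apply/negP => fac; apply: nna; exists a; last exact: nbhsx_ballx.
  by split => // t _; apply: le_trans fac _; exact: mc.2.
have g4 : 0 < (f a - f c) / 4 by rewrite divr_gt0.
move: (unif _ g4); apply: filterS => n hn t Kt mt.
apply: notA => // At.
have := ha t (mem_set At); have := mt.2 c I; have := hn t Kt; have := hn c Kc.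
by rewrite !ler_norml => /andP[? ?] /andP[? ?] ? ?; lra.
Qed.

(** The hypothesis on points outside of [K] confines all minimizations to [K];
    for [F n] it is available once [F n] is within [dl] of [f] there. *)
Lemma argmin_convergence (f : Theta -> R) (F : nat -> Theta -> R) (dl : R) :
  0 < dl ->
  {within K, continuous f} -> (forall n, {within K, continuous (F n)}) ->
  (forall G : Theta -> R, (G = f \/ exists n, G = F n) -> (forall t, K t -> `|G t - f t| <= dl) ->
    forall t, ~ K t -> exists2 s, K s & G s < G t) ->
  (forall e : R, 0 < e -> \forall n \near \oo, forall t, K t -> `|F n t - f t| <= e) ->
  [/\ argmin [set: Theta] f !=set0,
      \forall n \near \oo, argmin [set: Theta] (F n) !=set0
    & (fun n => ereal_sup [set edist_set t (argmin [set: Theta] f)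
                            | t in argmin [set: Theta] (F n)]) @ \oo --> (0%E : \bar R)].
Proof.
move=> dl0 cf cF dom unif.
have domf : forall t, ~ K t -> exists2 s, K s & f s < f t.
  by apply: dom; [left|move=> t _; rewrite subrr normr0 ltW].
have mf := argmin_nonempty cf domf.
have domF : \forall n \near \oo, forall t, ~ K t -> exists2 s, K s & F n s < F n t.
  by move: (unif dl dl0); apply: filterS => n hn; apply: dom => //; right; exists n.
have neF : \forall n \near \oo, argmin [set: Theta] (F n) !=set0.
  move: domF; apply: filterS => n hn.
  by have [c _ mc] := argmin_nonempty (cF n) hn; exists c.
have [c Kc mc] := mf.
split => //; first by exists c.
have bound (e : R) : 0 < e -> \forall n \near \oo,
    (0 <= ereal_sup [set edist_set t (argmin [set: Theta] f)
                            | t in argmin [set: Theta] (F n)] <= e%:E)%E.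
  move=> e0; move: (argmin_close cf mf unif e0) domF neF.
  apply: filterS3 => n hn domn [t0 mt0]; apply/andP; split.
    apply: (@le_trans _ _ (edist_set t0 (argmin [set: Theta] f))).
      by apply: le_ereal_inf_tmp => _ [s _ <-]; rewrite lee_fin mdist_ge0.
    by apply: ereal_sup_ubound; exists t0.
  apply: ge_ereal_sup => _ [t mt <-].
  have [s ms ts] := hn t (argmin_in domn mt) mt.
  apply: (@le_trans _ _ (mdist t s)%:E); last by rewrite lee_fin ltW.
  by apply: ereal_inf_lbound; exists s.
apply/fine_cvgP; split.
  move: (bound 1 ltr01); apply: filterS => n /andP[h0 h1].
  by rewrite fin_real// (lt_le_trans _ h0) ?ltNyr//= (le_lt_trans h1) ?ltry.
apply/cvgrPdist_le => e e0; move: (bound e e0); apply: filterS => n /andP[].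
set u := ereal_sup _ => h0 h1.
have fu : u \is a fin_num.
  by rewrite fin_real// (lt_le_trans _ h0) ?ltNyr//= (le_lt_trans h1) ?ltry.
by move: h0 h1; rewrite -(fineK fu) !lee_fin /= sub0r normrN => h0 h1; rewrite ger0_norm.
Qed.

End ArgminConvergence.

(** * The kernel Stein discrepancy as a mean embedding *)

Lemma uniform_limit_within (R : realType) (T : topologicalType) (A : set T)
    (F : nat -> T -> R) (f : T -> R) :
  (forall n, {within A, continuous (F n)}) ->
  (forall e : R, 0 < e -> \forall n \near \oo, forall t, A t -> `|F n t - f t| <= e) ->
  {within A, continuous f}.
Proof.
move=> cF unif; apply/subspace_continuousP => x Ax.
apply/cvgrPdist_lt => e e0; have e4 : 0 < e / 4 by rewrite divr_gt0.
have [n _ hn] := unif _ e4; have {}hn := hn n (leqnn n).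
have /subspace_continuousP/(_ x Ax)/cvgrPdist_lt/(_ _ e4) := cF n.
rewrite !near_withinE; apply: filterS => y h Ay.
have := h Ay; have := hn x Ax; have := hn y Ay.
rewrite /from_subspace !ler_norml !ltr_norml => /andP[? ?] /andP[? ?] /andP[? ?].
by apply/andP; split; lra.
Qed.

Section SteinLaw.
Context (R : realType) (m : nat) (G : lieGroupType R m)
  (mu : {measure set (borel G) -> \bar R}) (Delta : G -> R)
  (D : 'I_m -> vector_field G) (k : G -> G -> R) (H : rkhs k)
  (Theta : topologicalType) (p : Theta -> G -> R) (q w : G -> R)
  (Q : probability (borel G) R).
Hypothesis ksym : forall x y, k x y = k y x.
Hypothesis k2 : C2_kernel k.
Hypothesis mw : measurable_fun [set: borel G] (w : borel G -> R).
Hypothesis w0 : forall x, 0 < w x.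
Hypothesis QE : forall A : set (borel G), measurable A ->
  Q A = (\int[mu]_(x in A) (w x)%:E)%E.
Local Notation V := (fun theta => weighted_kernel D Delta H q w (p theta)).
Hypothesis V_cont : continuous (fun z : Theta * (G * G) => V z.1 z.2.1 z.2.2 : R^o).
Local Notation phi := (fun theta => weighted_feature D Delta k q w (p theta)).
Local Notation HH := (@rkhs_power R m G k H).

Lemma feature_continuous : continuous (fun z : Theta * (G * G) =>
  si_ip HH (phi z.1 z.2.1) (phi z.1 z.2.2) : R^o).
Proof.
rewrite (_ : (fun _ => _) = (fun z : Theta * (G * G) => V z.1 z.2.1 z.2.2 : R^o)) //.
by apply/funext => z; rewrite weighted_kernelE.
Qed.

Lemma feature_dom t x : si_dom HH (phi t x).
Proof. exact: weighted_feature_dom. Qed.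

(** The Stein operator is the inner product with the Stein feature, and the
    factor [w] of the feature's law cancels the weight. *)
Lemma KSD_mean_embedding t : KSD mu D Delta H (p t) q = mean_embedding_norm HH phi Q t.
Proof.
congr (ereal_sup _); apply: eq_imagel => f [df _].
have mphi : measurable_fun [set: borel G]
    (fun x : borel G => (si_ip HH f (phi t x))%:E).
  apply/measurable_EFinP; apply: continuous_borel_measurable.
  exact: (@feature_coord_continuous _ _ HH _ _ phi feature_dom feature_continuous t f df).
rewrite (integral_density mw (fun x => ltW (w0 x)) QE mphi).
apply: eq_integral => x _; rewrite -EFinM; congr EFin.
have dF := stein_feature_dom D Delta H ksym k2 (p t) x.
rewrite (@stein_featureE R m G D Delta k H ksym k2 (p t) f x df) si_ipZr//.
by field; rewrite gt_eqF.
Qed.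

Lemma wKSD_empirical n x t :
  wKSD D Delta H q w n x (p t) = si_norm HH (empirical_mean phi n x t).
Proof.
rewrite /wKSD /si_norm; congr Num.sqrt.
have dS : si_dom HH (\sum_(i < n) phi t (x i)).
  by apply: si_dom_sum => i _; exact: feature_dom.
rewrite /empirical_mean si_ipZl// ?si_ipZr//; last exact: si_domZ.
rewrite mulrA -expr2 exprVn; congr (_ * _).
rewrite si_ip_suml//; last by move=> i; exact: feature_dom.
apply: eq_bigr => i _; rewrite si_ip_sumr; [|by move=> j; exact: feature_dom|exact: feature_dom].
by apply: eq_bigr => j _; rewrite weighted_kernelE.
Qed.

(** The square root of the pointwise supremum of [V] over the parameters is the
    envelope required by the uniform law. *)
Lemma feature_envelope (K : set Theta) : compact K -> K !=set0 ->
  mu.-integrable [set: borel G]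
    (fun x => ereal_sup [set (V theta x x)%:E | theta in K] * (w x)%:E)%E ->
  exists g : G -> R, [/\ measurable_fun [set: borel G] (g : borel G -> R),
    forall t x, K t -> si_norm HH (phi t x) <= g x, forall x, 0 <= g x &
    (\int[Q]_x (g x ^+ 2)%:E < +oo)%E].
Proof.
move=> cK K0 iS.
pose S (x : G) := ereal_sup [set (V theta x x)%:E | theta in K].
have Vge0 t x : 0 <= V t x x.
  by rewrite (weighted_kernelE D Delta H ksym k2) si_ip_ge0//; exact: feature_dom.
have SE x : exists2 c, K c & S x = (V c x x)%:E /\ forall t, K t -> V t x x <= V c x x.
  have cV : {within K, continuous (fun t => V t x x)}.
    apply: continuous_subspaceT => t.
    have c3 : (fun t => (t, (x, x))) @ t --> (t, (x, x)).
      exact: (cvg_pair (@cvg_id _ _) (cvg_cst _)).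
    exact: (cvg_comp _ _ c3 (@V_cont (t, (x, x)))).
  have [c Kc hc] := compact_EVT_max K0 cK cV; rewrite inE in Kc.
  exists c => //; split; last by move=> t Kt; apply: hc; rewrite inE.
  apply/eqP; rewrite eq_le; apply/andP; split.
    by apply: ge_ereal_sup => _ [t Kt <-]; rewrite lee_fin; apply: hc; rewrite inE.
  by apply: ereal_sup_ubound; exists c.
pose s x := fine (S x).
have sE x : S x = (s x)%:E by rewrite /s; have [c _ [-> _]] := SE x.
have s0 x : 0 <= s x.
  by rewrite /s; have [c _ [-> _]] := SE x; exact: Vge0.
have ms : measurable_fun [set: borel G] (s : borel G -> R).
  have mSw : measurable_fun [set: borel G] (fun x : borel G => s x * w x).
    apply/measurable_EFinP; have := measurable_int _ iS.
    by congr (measurable_fun _ _); apply/funext => x; rewrite -/(S x) sE.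
  (* Measurability is known after multiplication by [w] only, so divide by [w]. *)
  have -> : (s : borel G -> R) = (fun x : borel G => s x * w x * w x `^ (-1)).
    by apply/funext => x; rewrite powR_inv1 ?ltW// mulfK// gt_eqF.
  apply: measurable_funM => //.
  exact: (measurableT_comp (measurable_powR (-1)) mw).
exists (fun x => Num.sqrt (s x)); split.
- exact: (measurableT_comp (continuous_measurable_fun (@sqrt_continuous R)) ms).
- move=> t x Kt; rewrite ler_wsqrtr//.
  rewrite -(weighted_kernelE D Delta H ksym k2) -lee_fin -sE.
  by apply: ereal_sup_ubound; exists t.
- by move=> x; exact: sqrtr_ge0.
- under eq_integral do rewrite sqr_sqrtr//.
  rewrite (ge0_integral_density mw (fun x => ltW (w0 x)) QE)//; last exact/measurable_EFinP.
  have := integrable_lty measurableT iS.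
  by congr (_ < _)%E; apply: eq_integral => x _; rewrite -/(S x) sE.
Qed.

Lemma wKSD_uniform_law (d : measure_display) (Omega : measurableType d)
    (P : probability Omega R) (X : nat -> {RV P >-> borel G}) (K : set Theta) :
  mutually_independent X ->
  (forall i A, measurable A -> distribution P (X i) A = Q A) ->
  compact K -> K !=set0 ->
  mu.-integrable [set: borel G]
    (fun x => ereal_sup [set (V theta x x)%:E | theta in K] * (w x)%:E)%E ->
  (forall t, K t -> KSD mu D Delta H (p t) q \is a fin_num) /\
  {ae P, forall omega, forall e : R, 0 < e -> \forall n \near \oo, forall t, K t ->
    `|wKSD D Delta H q w n (fun i => X i omega) (p t)
      - fine (KSD mu D Delta H (p t) q)| <= e}.
Proof.
move=> Xind Xlaw cK K0 iS; have [g [mg phig g0 g2]] := feature_envelope cK K0 iS.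
have [fin law] := uniform_law feature_dom feature_continuous
  (@lie_second_countable R m G) cK mg phig g0 g2 Xind Xlaw.
split; first by move=> t Kt; rewrite KSD_mean_embedding; exact: fin.
move: law; apply: filterS => omega h e e0; move: (h e e0).
apply: filterS => n hn t Kt; rewrite KSD_mean_embedding wKSD_empirical.
exact: hn.
Qed.

Lemma wKSD_continuous n (x : nat -> G) :
  continuous (fun t => wKSD D Delta H q w n x (p t)).
Proof.
move=> t; rewrite /wKSD.
have h : (fun t => (n%:R ^+ 2)^-1 * \sum_(i < n) \sum_(j < n) V t (x i) (x j)) @ t -->
    (n%:R ^+ 2)^-1 * \sum_(i < n) \sum_(j < n) V t (x i) (x j).
  apply: cvgM; first exact: cvg_cst.
  apply: cvg_big => [|i _]; first exact: (@add_continuous R^o).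
  apply: cvg_big => [|j _]; first exact: (@add_continuous R^o).
  have c3 : (fun t => (t, (x i, x j))) @ t --> (t, (x i, x j)).
    exact: (cvg_pair (@cvg_id _ _) (cvg_cst _)).
  exact: (cvg_comp _ _ c3 (@V_cont (t, (x i, x j)))).
exact: (cvg_comp _ _ h (@sqrt_continuous R _)).
Qed.

End SteinLaw.

Unset Implicit Arguments.
Set Strict Implicit.

Theorem theorem7 (R : realType) (m : nat) (G : lieGroupType R m)
  (mu : {measure set (borel G) -> \bar R}) (Delta : G -> R)
  (D : 'I_m -> vector_field G) (k : G -> G -> R) (H : rkhs k)
  (Theta : metricType R) (Theta1 : topologicalType) (N : nat)
  (Theta2 : set 'rV[R]_N)
  (pr : Theta -> Theta1 * 'rV[R]_N) (mk : Theta1 * 'rV[R]_N -> Theta)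
  (p : Theta -> G -> R) (q w : G -> R)
  (d : measure_display) (Omega : measurableType d) (P : probability Omega R)
  (X : nat -> {RV P >-> borel G}) :
  let ksd := fun theta => KSD mu D Delta H (p theta) q in
  let V := fun theta => weighted_kernel D Delta H q w (p theta) in
  let wksd := fun n omega theta =>
    wKSD D Delta H q w n (fun i => X i omega) (p theta) in
  let Theta0 := argmin [set: Theta] ksd in
  let Thetahat := fun n omega => argmin [set: Theta] (wksd n omega) in
  connected [set: G] ->
  left_haar mu ->
  modular_function mu Delta ->
  left_invariant_basis D ->
  positive_definite k ->
  C2_kernel k ->
  C0_universal H ->
  (forall theta, probability_density mu (p theta) /\
                 locally_lipschitz (p theta)) ->
  probability_density mu q ->
  locally_lipschitz q ->
  probability_density mu w ->
  (forall x, 0 < w x) ->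
  (forall theta r, r = p theta \/ r = q ->
     mu.-integrable [set: borel G]
       (fun x => (Num.sqrt (stein_kernel D Delta H (p theta) x x) * r x)%:E) /\
     (forall l, mu.-integrable [set: borel G]
       (fun x => (Dlog D l (fun y => p theta y / q y) x * r x)%:E))) ->
  [set: Theta] !=set0 ->
  connected [set: Theta] ->
  iid_samples mu w X ->
  continuous (fun z : Theta * (G * G) => V z.1 z.2.1 z.2.2 : R^o) ->
  (forall K : set Theta, compact K -> K !=set0 ->
     mu.-integrable [set: borel G]
       (fun x => ereal_sup [set (V theta x x)%:E | theta in K] * (w x)%:E)%E) ->
  is_product Theta2 pr mk ->
  compact [set: Theta1] ->
  convex_set Theta2 ->
  {ae P, forall omega, forall n theta1,
     convex_function Theta2 (fun t => wksd n omega (mk (theta1, t)))} ->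
  (forall theta1,
     let M := argmin Theta2 (fun t => ksd (mk (theta1, t))) in
     [/\ M !=set0, compact M & M `<=` interior Theta2]) ->
  {ae P, forall omega,
     [/\ Theta0 !=set0,
         \forall n \near \oo, Thetahat n omega !=set0
       & (fun n => ereal_sup [set edist_set theta Theta0
                               | theta in Thetahat n omega]) @ \oo
           --> (0%E : \bar R)]}.
Proof.
move=> ksd V wksd Theta0 Thetahat _ _ _ _ [ksym _] k2 _ _ _ _ wdens w0 _.
move=> [theta0 _] _ [Xind Xlaw] V_cont V_int [prT mkK pr_cont mk_cont] cTheta1 _.
move=> wconvex ksd_min.
have [mw _ _] := wdens.
pose Q : probability (borel G) R := distribution P (X 0%N).
have QE A : measurable A -> Q A = (\int[mu]_(x in A) (w x)%:E)%E by exact: Xlaw.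
have XQ i A : measurable A -> distribution P (X i) A = Q A.
  by move=> mA; rewrite QE// Xlaw.
pose f theta := fine (ksd theta).
have law K : compact K -> K !=set0 ->
    (forall t, K t -> ksd t \is a fin_num) /\
    {ae P, forall omega, forall e : R, 0 < e -> \forall n \near \oo, forall t, K t ->
      `|wksd n omega t - f t| <= e}.
  move=> cK K0.
  exact: (wKSD_uniform_law ksym k2 mw w0 QE V_cont Xind XQ cK K0 (V_int K cK K0)).
have ksdE t : ksd t = (f t)%:E.
  have [fin _] := law [set t] (compact_set1 (x := t)) (ex_intro _ t erefl).
  by rewrite fineK// fin.
have P_proper : ProperFilter (almost_everywhere P).
  apply: ae_properfilter_algebraOfSetsType.
  by rewrite [X in (_ < X)%E](_ : _ = 1%E) ?lte01//; exact: probability_setT.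
have wksd_cont n omega : continuous (wksd n omega) by exact: wKSD_continuous.
(* [f] is deterministic: continuity and convexity are read off from one outcome
   at which the empirical functions converge. *)
have f_cont K : compact K -> {within K, continuous f}.
  move=> cK; have [K0|K0] := pselect (K !=set0); last first.
    by apply/subspace_continuousP => t Kt; case: K0; exists t.
  have [_ /filter_ex[omega h]] := law K cK K0.
  apply: (uniform_limit_within (F := fun n => wksd n omega) _ h) => n.
  exact/continuous_subspaceT/wksd_cont.
have f_convex t1 : convex_function Theta2 (fun t => f (mk (t1, t))).
  move=> t x y Tx Ty.
  set c := conv t x y.
  (* The law on three points gives convergence at the points of the inequality. *)
  pose K := [set mk (t1, x)] `|` [set mk (t1, y)] `|` [set mk (t1, c)].
  have cK : compact K by do 2?[apply: compactU]; exact: compact_set1.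
  have K0 : K !=set0 by exists (mk (t1, c)); right.
  have [_ unif] := law K cK K0.
  have /filter_ex[omega [cvx h]] : {ae P, forall omega,
      (forall n t1, convex_function Theta2 (fun t => wksd n omega (mk (t1, t)))) /\
      (forall e : R, 0 < e -> \forall n \near \oo, forall t, K t ->
        `|wksd n omega t - f t| <= e)}.
    by move: wconvex unif; apply: filterS2 => omega.
  apply/ler_addgt0Pr => e e0; have e2 : 0 < e / 2 by rewrite divr_gt0.
  have [n _ hn] := h _ e2; have {}hn := hn n (leqnn n).
  have hc0 : wksd n omega (mk (t1, c)) <=
      t%:num * wksd n omega (mk (t1, x)) + (1 - t%:num) * wksd n omega (mk (t1, y)).
    exact: (cvx n t1 t x y Tx Ty).
  suff : f (mk (t1, c)) <= t%:num * f (mk (t1, x)) + (1 - t%:num) * f (mk (t1, y)) + e.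
    exact.
  move: hc0.
  have := hn (mk (t1, x)) (or_introl (or_introl erefl)).
  have := hn (mk (t1, y)) (or_introl (or_intror erefl)).
  have := hn (mk (t1, c)) (or_intror erefl).
  have s0 : 0 <= t%:num by [].
  have s1 : t%:num <= 1 by [].
  move: (wksd n omega (mk (t1, x)) : R) (wksd n omega (mk (t1, y)) : R)
    (wksd n omega (mk (t1, c)) : R) (f (mk (t1, x)) : R) (f (mk (t1, y)) : R)
    (f (mk (t1, c)) : R) (t%:num : R) s0 s1.
  move=> Fx Fy Fc fx fy fc s s0 s1.
  rewrite !ler_norml => /andP[c1 c2] /andP[y1 y2] /andP[x1 x2] hc.
  have : s * (Fx - fx) <= s * (e / 2) by rewrite ler_wpM2l.
  have : (1 - s) * (Fy - fy) <= (1 - s) * (e / 2) by rewrite ler_wpM2l ?subr_ge0.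
  lra.
have argminE (T : Type) (A : set T) (j : T -> Theta) :
    argmin A (fun t => ksd (j t)) = argmin A (fun t => f (j t)).
  by apply: argmin_EFin => t; exact: ksdE.
have mk_within C : C `<=` Theta2 -> {within [set: Theta1] `*` C, continuous mk}.
  by move=> CT; apply: continuous_subspaceW mk_cont => -[a b] [_ /CT].
have compact_mk C : compact C -> C `<=` Theta2 -> compact (mk @` ([set: Theta1] `*` C)).
  move=> cC CT; apply: continuous_compact; first exact: mk_within.
  exact: compact_setX.
have fmk_cont C : compact C -> C `<=` Theta2 ->
    {within [set: Theta1] `*` C, continuous (f \o mk)}.
  move=> cC CT; have cK := compact_mk C cC CT.
  have [K0|K0] := pselect (mk @` ([set: Theta1] `*` C) !=set0); last first.
    by apply/subspace_continuousP => z Cz; case: K0; exists (mk z), z.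
  have [_ /filter_ex[omega h]] := law _ cK K0.
  apply: (uniform_limit_within (F := fun n => wksd n omega \o mk)) => [n|e e0].
    move=> z; apply: (@continuous_comp (subspace ([set: Theta1] `*` C))).
      exact: (mk_within C CT z).
    exact: wksd_cont.
  by move: (h e e0); apply: filterS => n hn z Cz; apply: hn; exists z.
have f_min t1 : let M := argmin Theta2 (fun t => (f \o mk) (t1, t)) in
    [/\ M !=set0, compact M & M `<=` interior Theta2].
  by have := ksd_min t1; rewrite /= argminE.
have [C [dl [cC CT dl0 loc]]] := convex_localization cTheta1 fmk_cont f_min.
pose K := mk @` ([set: Theta1] `*` C).
have cK : compact K by exact: compact_mk.
have K0 : K !=set0.
  by have [x0 Cx0 _] := loc (pr theta0).1; exists (mk ((pr theta0).1, x0)), ((pr theta0).1, x0).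
have dom (F : Theta -> R) : (forall t1, convex_function Theta2 (fun t => F (mk (t1, t)))) ->
    (forall t, K t -> `|F t - f t| <= dl) ->
    forall t, ~ K t -> exists2 s, K s & F s < F t.
  move=> cF hF t nKt; have [T2t mkt] := prT t.
  have [x0 Cx0 hx] := loc (pr t).1.
  exists (mk ((pr t).1, x0)); first by exists ((pr t).1, x0).
  rewrite -[in ltRHS]mkt [in ltRHS](surjective_pairing (pr t)).
  apply: (hx (fun z => F (mk ((pr t).1, z)))) => //.
    by move=> z Cz; apply: hF; exists ((pr t).1, z).
  by move=> Ct; apply: nKt; exists (pr t).
have Theta0E : Theta0 = argmin [set: Theta] f by exact: argminE.
have [_ unif] := law K cK K0.
move: wconvex unif; apply: filterS2 => omega cvx unif.
rewrite Theta0E; apply: (argmin_convergence cK K0 dl0) => //.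
- exact: f_cont.
- by move=> n; exact/continuous_subspaceT/wksd_cont.
- by move=> F [->|[n ->]]; apply: dom => // t1; exact: cvx.
Qed.
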